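(* Let $n \geqslant 2.16\times 10^{17}$ and let $G$ be a planar graph on $n$ vertices that does not contain $C_{3,3}$ as a subgraph. Then $\rho(G)\leqslant \rho(K_2+H(1,1))$, with equality if and only if $G\cong K_2+H(1,1)$. Here $H(1,1)$ is the graph consisting of $n-2$ isolated vertices, so $K_2+H(1,1)$ is the graph on $n$ vertices obtained from an edge $u'u''$ and $n-2$ further vertices, each adjacent to both $u'$ and $u''$ (and to nothing else).
   Context: All graphs are finite and simple. $\rho(G)$ denotes the spectral radius (largest eigenvalue modulus) of the adjacency matrix of $G$. For $l\geqslant 3$, $C_{l,l}$ denotes the graph consisting of two cycles of length $l$ sharing exactly one common vertex (so it has $2l-1$ vertices); $C_{3,3}$ is two triangles sharing a vertex. For graphs $G_1,G_2$, $G_1+G_2$ denotes their join: the disjoint union of $G_1$ and $G_2$ together with all edges joining every vertex of $G_1$ to every vertex of $G_2$. $K_2$ is the complete graph on two vertices. *)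

(* Defs.v *)
From HB Require Import structures.
From mathcomp Require Import all_boot all_order all_algebra.
From mathcomp Require Import all_classical all_reals all_analysis.
Set Implicit Arguments. Unset Strict Implicit. Unset Printing Implicit Defensive.
Import Order.TTheory GRing.Theory Num.Theory.
Import numFieldNormedType.Exports.
Local Open Scope classical_set_scope.
Local Open Scope ring_scope.

Definition simple_graph (n : nat) (e : rel 'I_n) : Prop :=
  (forall x, ~~ e x x) /\ (forall x y, e x y = e y x).

Definition adjmx (R : realType) (n : nat) (e : rel 'I_n) : 'M[R]_n :=
  \matrix_(i, j) (e i j)%:R.

(* Spectral radius: largest modulus of an eigenvalue.  Adjacency matrices are
   real symmetric, so all eigenvalues are real. *)
Definition spectral_radius (R : realType) (n : nat) (A : 'M[R]_n) : R :=
  sup [set `|a| | a in [set a : R | eigenvalue A a]].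

Definition rho (R : realType) (n : nat) (e : rel 'I_n) : R :=
  spectral_radius (adjmx R e).

Definition planar (R : realType) (n : nat) (e : rel 'I_n) : Prop :=
  exists (pos : 'I_n -> (R * R)%type) (arc : 'I_n -> 'I_n -> R -> (R * R)%type),
    injective pos /\
    (forall x y, e x y ->
       {within `[(0:R), 1]%classic, continuous (arc x y)} /\
       arc x y 0 = pos x /\ arc x y 1 = pos y /\
       {in `[(0:R), 1]%classic &, injective (arc x y)} /\
       (forall s z, 0 < s < 1 -> arc x y s <> pos z)) /\
    (forall x y u v s t, e x y -> e u v -> 0 < s < 1 -> 0 < t < 1 ->
       arc x y s = arc u v t ->
       (x == u) && (y == v) || (x == v) && (y == u)).

(* G contains C_{3,3} (two triangles sharing one vertex) as a subgraph. *)
Definition C33_edge (i j : 'I_5) : bool :=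
  let a := val i in let b := val j in
  (a != b) &&
  [|| (a == 0%N) && (b != 0%N), (b == 0%N) && (a != 0%N),
      [&& a \in [:: 1; 2]%N & b \in [:: 1; 2]%N] |
      [&& a \in [:: 3; 4]%N & b \in [:: 3; 4]%N]].

Definition contains_C33 (n : nat) (e : rel 'I_n) : Prop :=
  exists f : 'I_5 -> 'I_n, injective f /\
    forall i j, C33_edge i j -> e (f i) (f j).

Definition K2_join_H11 (n : nat) : rel 'I_n :=
  fun x y => (x != y) && ((val x < 2)%N || (val y < 2)%N).

Definition graph_iso (n : nat) (e1 e2 : rel 'I_n) : Prop :=
  exists f : 'I_n -> 'I_n, bijective f /\ forall x y, e1 x y = e2 (f x) (f y).

(* Main.v *)
Require Import Defs.
From HB Require Import structures.
From mathcomp Require Import all_boot all_order all_algebra.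
From mathcomp Require Import all_classical all_reals all_analysis.
From mathcomp Require Import perm ring lra zify.
From mathcomp Require polyrcf.
Import Order.TTheory GRing.Theory Num.Theory.
Set Implicit Arguments. Unset Strict Implicit. Unset Printing Implicit Defensive.
Local Open Scope ring_scope.

(* Planarity enters only through minors.  For two disjoint plane paths the vector
   from a point of one to a point of the other is a nonvanishing function on a
   square, so its winding along the boundary is zero; read modulo 2 and summed over
   the 18 pairs of vertex-disjoint edges of K_{3,3}, this is contradictory.  So K_{3,3}
   has no drawing in which vertex-disjoint edges are disjoint, even if adjacent
   edges may cross.  Such weak drawings survive edge contraction, whence a planar
   graph has no K_{3,3} and at most 6(n - 1) edges: contract edges lying in few
   triangles, otherwise pass to a neighbourhood, twice.

   Let l = rho(K_2 + H(1,1)), i.e. l^2 = l + 2(n - 2).  If G has an eigenvalue of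
   modulus at least l, then the absolute values y of an eigenvector, scaled to
   maximum 1, satisfy l y <= A y.  Counting 2-walks with the two facts above gives
   vertices z, z' with y z = 1 and y z' >= 0.97 that have at least 0.945 n common
   neighbours, while y <= 0.07 elsewhere.  Replacing the edges of G by those of
   K_2 + H(1,1) with dominating pair z, z' does not decrease the quadratic form of y,
   and the form of K_2 + H(1,1) is at most l |y|^2; the equality case forces z, z'
   to be adjacent to each other and to everything else, and then C_{3,3}-freeness
   leaves no further edge. *)

(** * Crossing parity of discrete paths *)

Section CrossingParity.
Variable R : realFieldType.
Implicit Types (d : R) (u v w a b p q : R * R) (s t : seq (R * R)).

(** Only one of the two boundary rays is included, so that exactly one of [u] and [- u] is upper
    when [u] is nonzero. *)
Definition upper u := (0 < u.2) || (u.2 == 0) && (0 < u.1).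

(* For u, v nearby and away from 0: whether going from u to v crosses the positive
   first half-axis. *)
Definition crosses u v := (upper u (+) upper v) && (0 < u.1).

Definition nearby d u v := (`|u.1 - v.1| < d) && (`|u.2 - v.2| < d).

Definition far d u v := (d <= `|u.1 - v.1|) || (d <= `|u.2 - v.2|).

Definition big d u := (d <= `|u.1|) || (d <= `|u.2|).

Lemma upper_neg u v : 0 < `|u.1 - v.1| \/ 0 < `|u.2 - v.2| -> upper (u - v) = ~~ upper (v - u).
Proof.
rewrite /upper /= !subr_gt0 !subr_eq0 !normr_gt0 !subr_eq0 => H.
have [h|h|h] := ltgtP u.2 v.2; rewrite //=.
by have [h'|h'|h'] := ltgtP u.1 v.1; rewrite //= in H *; case: H; rewrite ?h' ?h eqxx.
Qed.

(** A step shorter than [d] that changes half-plane has both second coordinates below [d] in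
    modulus. Bigness then makes the first coordinates at least [d] in modulus, too large for the
    step to change their sign. *)
Lemma crosses_same_side d u v : 0 < d -> nearby d u v -> big d u -> big d v ->
  upper u (+) upper v -> (0 < u.1) = (0 < v.1) /\ u.1 != 0 /\ `|u.2| < d /\ `|v.2| < d.
Proof.
rewrite /nearby /big /upper => d0 /andP[]; rewrite !ltr_norml !ler_normr.
move=> /andP[h1 h2] /andP[h3 h4] bu bv hup.
have hy : (- d < u.2 < d) /\ (- d < v.2 < d).
  move: hup; have [k1|k1|k1] := ltgtP 0 u.2; have [k2|k2|k2] := ltgtP 0 v.2;
    rewrite //= ?addbT ?addbF; lra.
case: hy => /andP[y1 y2] /andP[y3 y4].
have {}bu : d <= u.1 \/ d <= - u.1 by case/orP: bu => /orP[]; [left|right| |]; lra.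
have {}bv : d <= v.1 \/ d <= - v.1 by case/orP: bv => /orP[]; [left|right| |]; lra.
split; last by split; [apply/eqP => h0; rewrite h0 in bu|]; lra.
by apply/idP/idP => ?; lra.
Qed.

(** Negation exchanges the two halves of the first axis, and a change of half-plane crosses exactly
    one of them. *)
Lemma crosses_opp d u v : 0 < d -> nearby d u v -> big d u -> big d v ->
  crosses (- u) (- v) = crosses u v (+) (upper u (+) upper v).
Proof.
move=> d0 c bu bv.
have N w : big d w -> upper (- w) = ~~ upper w.
  move=> bw; rewrite -{2}[w]subr0 -[- w]sub0r; apply: upper_neg.
  rewrite /= !sub0r !normrN; case/orP: bw; [left|right]; exact: lt_le_trans d0 _.
rewrite /crosses !N // addbN addNb negbK.
case h : (_ (+) _) => //=.
have [_ [u0 _]] := crosses_same_side d0 c bu bv h.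
by rewrite oppr_gt0 addbT -leNgt le_eqVlt (negbTE u0).
Qed.

(** Discrete form of the fact that a small triangle away from the origin has winding number zero. *)
Lemma crosses_trans d u v w : 0 < d -> nearby d u v -> nearby d v w -> nearby d u w ->
  big d u -> big d v -> big d w ->
  crosses u v (+) crosses v w = crosses u w.
Proof.
move=> d0 cuv cvw cuw bu bv bw.
have h1 := crosses_same_side d0 cuv bu bv.
have h2 := crosses_same_side d0 cvw bv bw.
have h3 := crosses_same_side d0 cuw bu bw.
rewrite /crosses; case hu : (upper u) h1 h2 h3; case hv : (upper v);
  case hw : (upper w) => //= h1 h2 h3.
- by case: (h2 isT) => -> _; case: (h3 isT) => ->.
- by case: (h1 isT) => <- _; rewrite addbb.
- by rewrite addbF.
- by rewrite addbF.
- by case: (h1 isT) => <- _; rewrite addbb.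
- by case: (h2 isT) => -> _; case: (h3 isT) => ->.
Qed.

Fixpoint walk_parity (f : R * R -> R * R) p s : bool :=
  if s is q :: s' then crosses (f p) (f q) (+) walk_parity f q s' else false.

Lemma nearby_sub d a a' b b' : nearby d a a' -> nearby d b b' ->
  nearby (2 * d) (a - b) (a' - b').
Proof.
rewrite /nearby /= => /andP[]; rewrite !ltr_norml => /andP[h1 h2] /andP[h3 h4].
move=> /andP[/andP[h5 h6] /andP[h7 h8]].
by apply/andP; split; apply/andP; split; lra.
Qed.

Lemma nearbyxx d a : 0 < d -> nearby d a a.
Proof. by move=> d0; rewrite /nearby !subrr normr0 d0. Qed.

Lemma far_big d a b : far d a b -> big d (a - b).
Proof. by []. Qed.

(** Each step of the walk spans a quadrilateral of differences, which a diagonal cuts into two small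
    triangles; the sides shared by consecutive quadrilaterals cancel. *)
Lemma walk_parity_strip d a s b b' : 0 < d -> path (nearby d) a s -> nearby d b b' ->
  {in a :: s, forall p, far (2 * d) p b /\ far (2 * d) p b'} ->
  walk_parity (fun p => p - b) a s (+) walk_parity (fun p => p - b') a s =
  crosses (a - b) (a - b') (+) crosses (last a s - b) (last a s - b').
Proof.
move=> d0 + cb; elim: s a => [|a' s IH] a /=; first by rewrite addbb.
move=> /andP[ca pa] H.
have d20 : 0 < 2 * d by rewrite mulr_gt0.
have [fa fa'] := H a (mem_head _ _).
have [ga ga'] : far (2 * d) a' b /\ far (2 * d) a' b' by apply: H; rewrite !inE eqxx orbT.
have {}IH := IH a' pa (fun p hp => H p (mem_behead (s := a :: a' :: s) hp)).
rewrite addbACA {}IH.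
have cbb := nearbyxx b d0. have cbb' := nearbyxx b' d0.
have caa := nearbyxx a d0. have caa' := nearbyxx a' d0.
have E1 := crosses_trans d20 (nearby_sub ca cbb) (nearby_sub caa' cb) (nearby_sub ca cb)
  (far_big fa) (far_big ga) (far_big ga').
have E2 := crosses_trans d20 (nearby_sub caa cb) (nearby_sub ca cbb') (nearby_sub ca cb)
  (far_big fa) (far_big fa') (far_big ga').
by move: E1 E2; do 6 case: (crosses _ _).
Qed.

(** The strips for the successive steps of [t] add up to the whole square of differences. *)
Lemma walk_parity_square d a s b t : 0 < d ->
  path (nearby d) a s -> path (nearby d) b t ->
  {in a :: s & b :: t, forall p q, far (2 * d) p q} ->
  walk_parity (fun p => p - b) a s (+) walk_parity (fun p => p - last b t) a s =
  walk_parity (fun q => a - q) b t (+) walk_parity (fun q => last a s - q) b t.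
Proof.
move=> d0 pa; elim: t b => [|b' t IH] b /=; first by rewrite addbb.
move=> /andP[cb pb] H.
have {}IH := IH b' pb (fun p q hp hq => H p q hp (mem_behead (s := b :: b' :: t) hq)).
have /walk_parity_strip E : path (nearby d) a s by [].
have {}E := E _ _ d0 cb.
rewrite addbACA -{}IH -E; first by rewrite addbA addbK.
by move=> p hp; split; apply: H; rewrite ?inE ?eqxx ?orbT.
Qed.

Lemma walk_parity_opp d a b t : 0 < d -> path (nearby d) b t ->
  {in b :: t, forall q, far (2 * d) a q} ->
  walk_parity (fun q => a - q) b t =
  walk_parity (fun q => q - a) b t (+) (upper (b - a) (+) upper (last b t - a)).
Proof.
move=> d0; elim: t b => [|b' t IH] b /=; first by rewrite addbb.
move=> /andP[cb pb] H.
rewrite (IH b' pb (fun q hq => H q (mem_behead (s := b :: b' :: t) hq))).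
have bb q : q \in b :: b' :: t -> big (2 * d) (q - a).
  by move=> /H; rewrite /far /big /= distrC [in X in _ || X]distrC.
have cba : nearby (2 * d) (b - a) (b' - a) by apply: nearby_sub => //; exact: nearbyxx.
have := crosses_opp (mulr_gt0 (ltr0Sn _ 1) d0) cba (bb b _) (bb b' _).
rewrite !opprB => ->; rewrite ?inE ?eqxx ?orbT //.
by do 3 case: (upper _); do 2 case: (walk_parity _ _ _); case: (crosses _ _).
Qed.

(** The boundary of the square, with every side rewritten as a path seen from an end of the other
    path. In this form the same term recurs for different pairs of edges; the changes of sign leave
    the [upper] bits. *)
Lemma walk_parity_disjoint d a s b t : 0 < d ->
  path (nearby d) a s -> path (nearby d) b t ->
  {in a :: s & b :: t, forall p q, far (2 * d) p q} ->
  walk_parity (fun p => p - b) a s (+) walk_parity (fun p => p - last b t) a s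
  (+) (walk_parity (fun q => q - a) b t (+) walk_parity (fun q => q - last a s) b t) =
  upper (b - a) (+) upper (last b t - a) (+)
  (upper (b - last a s) (+) upper (last b t - last a s)).
Proof.
move=> d0 pa pb H.
rewrite (walk_parity_square d0 pa pb H).
rewrite !(walk_parity_opp d0 pb); first last.
- by move=> q hq; apply: H => //; rewrite mem_head.
- by move=> q hq; apply: H => //; rewrite mem_last.
by do 4 case: (upper _); do 2 case: (walk_parity _ _ _).
Qed.

End CrossingParity.

(** * Weak drawings *)

Lemma xor8_even (b1 b2 b3 b4 b5 b6 b7 b8 : bool) :
  b1 (+) b2 (+) (b3 (+) b4) = b5 (+) b6 (+) (b7 (+) b8) ->
  exists k : nat, (b1 + b2 + (b3 + b4) + (b5 + b6 + (b7 + b8)) = 2 * k)%N.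
Proof.
move=> H; exists ((b1 + b2 + (b3 + b4) + (b5 + b6 + (b7 + b8)))./2)%N.
by move: H; case: b1; case: b2; case: b3; case: b4; case: b5; case: b6; case: b7; case: b8.
Qed.

(** In the sum over [i < i'] and [j != j'], every [wa] and [wb] term occurs twice, every [hA] six
    times, and every [hM] and its negation an even number of times. But [hB j k] and [hB k j]
    together give 1, for three pairs of columns and three pairs of rows: 9 is odd. *)
Lemma K33_parity (wa wb : nat -> nat -> nat -> bool) (hA hB hM : nat -> nat -> bool) :
  (forall j k, j != k -> hB j k = ~~ hB k j) ->
  (forall i j i' j', i != i' -> j != j' -> (i < 3)%N -> (j < 3)%N -> (i' < 3)%N -> (j' < 3)%N ->
    wa i j i' (+) wb i j j' (+) (wa i' j' i (+) wb i' j' j) =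
    hA i' i (+) ~~ hM i j' (+) (hM i' j (+) hB j' j)) -> False.
Proof.
move=> hBN H.
have {}H i j i' j' h1 h2 h3 h4 h5 h6 := xor8_even (H i j i' j' h1 h2 h3 h4 h5 h6).
have N (b : bool) : (b + ~~ b = 1)%N by case: b.
have [k1 E1] := H 0 0 1 1 isT isT isT isT isT isT.
have [k2 E2] := H 0 1 1 0 isT isT isT isT isT isT.
have [k3 E3] := H 0 0 1 2 isT isT isT isT isT isT.
have [k4 E4] := H 0 2 1 0 isT isT isT isT isT isT.
have [k5 E5] := H 0 1 1 2 isT isT isT isT isT isT.
have [k6 E6] := H 0 2 1 1 isT isT isT isT isT isT.
have [k7 E7] := H 0 0 2 1 isT isT isT isT isT isT.
have [k8 E8] := H 0 1 2 0 isT isT isT isT isT isT.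
have [k9 E9] := H 0 0 2 2 isT isT isT isT isT isT.
have [k10 E10] := H 0 2 2 0 isT isT isT isT isT isT.
have [k11 E11] := H 0 1 2 2 isT isT isT isT isT isT.
have [k12 E12] := H 0 2 2 1 isT isT isT isT isT isT.
have [k13 E13] := H 1 0 2 1 isT isT isT isT isT isT.
have [k14 E14] := H 1 1 2 0 isT isT isT isT isT isT.
have [k15 E15] := H 1 0 2 2 isT isT isT isT isT isT.
have [k16 E16] := H 1 2 2 0 isT isT isT isT isT isT.
have [k17 E17] := H 1 1 2 2 isT isT isT isT isT isT.
have [k18 E18] := H 1 2 2 1 isT isT isT isT isT isT.
have n1 := hBN 1 0 isT; have n2 := hBN 2 0 isT; have n3 := hBN 2 1 isT.
have T := f_equal2 addn (f_equal2 addn (f_equal2 addn (f_equal2 addn E1 E2) (f_equal2 addn E3 E4))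
  (f_equal2 addn (f_equal2 addn E5 E6) (f_equal2 addn E7 E8)))
  (f_equal2 addn (f_equal2 addn (f_equal2 addn (f_equal2 addn E9 E10) (f_equal2 addn E11 E12))
  (f_equal2 addn (f_equal2 addn E13 E14) (f_equal2 addn E15 E16))) (f_equal2 addn E17 E18)).
clear E1 E2 E3 E4 E5 E6 E7 E8 E9 E10 E11 E12 E13 E14 E15 E16 E17 E18 H.
rewrite n1 n2 n3 in T; clear n1 n2 n3 hBN; move: T.
move: (N (hM 0 0)) (N (hM 0 1)) (N (hM 0 2)) (N (hM 1 0)) (N (hM 1 1)) (N (hM 1 2))
  (N (hM 2 0)) (N (hM 2 1)) (N (hM 2 2)) (N (hB 0 1)) (N (hB 0 2)) (N (hB 1 2)).
repeat match goal with |- context [nat_of_bool ?b] =>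
  let x := fresh "x" in generalize (nat_of_bool b); intro x end.
clear; lia.
Qed.

Section WeakDrawing.
Import mathcomp.boot.fintype mathcomp.boot.finset.
Variables (R : realFieldType) (V : finType).
Implicit Types (S Z : {set V}) (e : rel V).

(* Edges are drawn as d-chains of points; only vertex-disjoint edges have to be
   drawn apart, which makes the notion stable under edge contraction. *)
Definition weak_drawing S e : Prop :=
  exists (d : R) (pos : V -> R * R) (chain : V -> V -> seq (R * R)),
  [/\ 0 < d,
      (forall x y, x \in S -> y \in S -> e x y ->
         path (nearby d) (pos x) (chain x y) /\ last (pos x) (chain x y) = pos y) &
      (forall x y u v, x \in S -> y \in S -> u \in S -> v \in S -> e x y -> e u v ->
         uniq [:: x; y; u; v] ->
         {in pos x :: chain x y & pos u :: chain u v, forall p q, far (2 * d) p q})].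

Lemma weak_drawing_K33_free S e (a b : nat -> V) : weak_drawing S e ->
  (forall i, (i < 3)%N -> a i \in S) -> (forall i, (i < 3)%N -> b i \in S) ->
  (forall i j, (i < 3)%N -> (j < 3)%N -> i != j -> a i != a j) ->
  (forall i j, (i < 3)%N -> (j < 3)%N -> i != j -> b i != b j) ->
  (forall i j, (i < 3)%N -> (j < 3)%N -> a i != b j) ->
  (forall i j, (i < 3)%N -> (j < 3)%N -> e (a i) (b j)) -> False.
Proof.
move=> [d [pos [ch [d0 Hch Hfar]]]] aS bS ainj binj ab eab.
have Hf i j i' j' : i != i' -> j != j' -> (i < 3)%N -> (j < 3)%N -> (i' < 3)%N -> (j' < 3)%N ->
    {in pos (a i) :: ch (a i) (b j) & pos (a i') :: ch (a i') (b j'),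
    forall p q, far (2 * d) p q}.
  move=> ii jj i3 j3 i3' j3'; apply: Hfar; rewrite ?aS ?bS ?eab //=.
  rewrite !inE !negb_or !ab // ainj // binj // [b j == a _]eq_sym ab //.
have far_upper p q : far (2 * d) p q -> upper (p - q) = ~~ upper (q - p).
  move=> h; apply: upper_neg; case/orP: h => h; [left|right]; apply: lt_le_trans h; lra.
pose W i j q := walk_parity (fun p => p - q) (pos (a i)) (ch (a i) (b j)).
(* Outside the index range the bit for a pair of [b] vertices defaults to [j < j'], which keeps the
   antisymmetry hypothesis true for all indices. *)
apply: (@K33_parity (fun i j i' => W i j (pos (a i'))) (fun i j j' => W i j (pos (b j')))
  (fun i i' => upper (pos (a i) - pos (a i')))
  (fun j j' => if (j < 3)%N && (j' < 3)%N then upper (pos (b j) - pos (b j')) else (j < j')%N)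
  (fun i j => upper (pos (a i) - pos (b j)))).
  move=> j k jk; rewrite [in RHS]andbC; case: ifP => [/andP[j3 k3]|_]; last first.
    by rewrite -leqNgt ltn_neqAle jk.
  apply: far_upper.
  (* The positions of [b j] and [b k] are ends of two disjoint edges, from [a 0] and from [a 1]. *)
  apply: (Hf 0 j 1 k isT jk isT j3 isT k3).
    have [_ <-] := Hch _ _ (aS 0 isT) (bS j j3) (eab 0 j isT j3).
    exact: mem_last.
  have [_ <-] := Hch _ _ (aS 1 isT) (bS k k3) (eab 1 k isT k3).
  exact: mem_last.
move=> i j i' j' ii jj i3 j3 i3' j3'.
have [p1 l1] := Hch _ _ (aS i i3) (bS j j3) (eab i j i3 j3).
have [p2 l2] := Hch _ _ (aS i' i3') (bS j' j3') (eab i' j' i3' j3').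
have := walk_parity_disjoint d0 p1 p2 (Hf i j i' j' ii jj i3 j3 i3' j3').
rewrite l1 l2 -/(W _ _ _) -/(W _ _ _) => ->.
rewrite j3 j3' /= -far_upper //.
have := Hf i j i' j' ii jj i3 j3 i3' j3' (pos (a i)) (pos (b j')) (mem_head _ _).
rewrite /far distrC [in X in _ || X]distrC; apply.
by rewrite -l2 mem_last.
Qed.

Definition sgraph e := (forall x, ~~ e x x) /\ (forall x y, e x y = e y x).

Lemma sgraph_neq e x y : sgraph e -> e x y -> x != y.
Proof. by move=> [irr _] exy; apply: contraTneq exy => ->. Qed.

(** [v] is merged into [u] but stays in the type with its old edges; passing from [S] to [S :\ v]
    discards it. *)
Definition edge_contract e (u v : V) : rel V := fun x y =>
  (x != y) && [|| e x y, (x == u) && e v y | (y == u) && e x v].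

Lemma sgraph_contract e u v : sgraph e -> sgraph (edge_contract e u v).
Proof.
move=> [irr sym]; split=> [x|x y]; first by rewrite /edge_contract eqxx.
by rewrite /edge_contract eq_sym sym [e v y]sym [e x v]sym [X in _ || X]orbC.
Qed.

Lemma weak_drawing_sub S S' e : S' \subset S -> weak_drawing S e -> weak_drawing S' e.
Proof.
move=> /subsetP sub [d [pos [ch [d0 Hch Hfar]]]]; exists d, pos, ch; split=> //.
  by move=> x y /sub xS /sub yS; apply: Hch.
by move=> x y u v /sub xS /sub yS /sub uS /sub vS; apply: Hfar.
Qed.

(** An edge that [u] inherits from [v] is redrawn through [v]. It may then meet other edges at [u],
    which a weak drawing permits. *)
Lemma weak_drawing_contract S e u v : sgraph e -> u \in S -> v \in S -> e u v ->
  weak_drawing S e -> weak_drawing (S :\ v) (edge_contract e u v).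
Proof.
move=> ge; have [irr sym] := ge; move=> uS vS euv [d [pos [ch [d0 Hch Hfar]]]].
pose ch' x y := if e x y then ch x y else
  if x == u then ch u v ++ ch v y else ch x v ++ ch v u.
have evu : e v u by rewrite sym.
(* Every point of a redrawn edge lies on an old edge whose ends are ends of the new one, or [v] in
   case [u] is such an end. Hence disjoint new edges use disjoint old ones. *)
have on x y p : x \in S :\ v -> y \in S :\ v -> edge_contract e u v x y -> p \in pos x :: ch' x y ->
    exists a b, [/\ a \in S, b \in S, e a b, p \in pos a :: ch a b &
     forall c, c \in [:: a; b] -> c \in [:: x; y] \/ c = v /\ u \in [:: x; y]].
  rewrite !inE => /andP[xv xS] /andP[yv yS] /andP[xy]; rewrite /ch'.
  case: ifP => exy /=.
    by move=> _ hp; exists x, y; split=> // c; rewrite !inE; left.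
  case: eqP => [xu|xu] /=; first subst x.
    move=> /orP[evy|/andP[/eqP yu _]]; last by rewrite yu eqxx in xy.
    rewrite mem_cat => /or3P[hp|hp|hp].
    - exists u, v; split=> //; first by rewrite inE hp.
      by move=> c; rewrite !inE => /orP[/eqP->|/eqP->]; rewrite eqxx; [left|right].
    - exists u, v; split=> //; first by rewrite inE hp orbT.
      by move=> c; rewrite !inE => /orP[/eqP->|/eqP->]; rewrite eqxx; [left|right].
    - exists v, y; split=> //; first by rewrite inE hp orbT.
      by move=> c; rewrite !inE => /orP[/eqP->|/eqP->]; rewrite eqxx ?orbT; [right|left].
  move=> /andP[/eqP-> exv]; rewrite mem_cat => /or3P[hp|hp|hp].
  - exists x, v; split=> //; first by rewrite inE hp.
    by move=> c; rewrite !inE => /orP[/eqP->|/eqP->]; rewrite eqxx ?orbT; [left|right].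
  - exists x, v; split=> //; first by rewrite inE hp orbT.
    by move=> c; rewrite !inE => /orP[/eqP->|/eqP->]; rewrite eqxx ?orbT; [left|right].
  - exists v, u; split=> //; first by rewrite inE hp orbT.
    by move=> c; rewrite !inE => /orP[/eqP->|/eqP->]; rewrite eqxx ?orbT; [right|left].
exists d, pos, ch'; split=> //.
  move=> x y; rewrite !inE => /andP[xv xS] /andP[yv yS] /andP[xy]; rewrite /ch'.
  case: ifP => exy /=; first by move=> _; apply: Hch.
  case: eqP => [xu|xu] /=; first subst x.
    move=> /orP[evy|/andP[/eqP yu _]]; last by rewrite yu eqxx in xy.
    have [p1 l1] := Hch _ _ uS vS euv; have [p2 l2] := Hch _ _ vS yS evy.
    by rewrite cat_path last_cat l1 p1.
  move=> /andP[/eqP-> exv].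
  have [p1 l1] := Hch _ _ xS vS exv; have [p2 l2] := Hch _ _ vS uS evu.
  by rewrite cat_path last_cat l1 p1.
move=> x y x' y' xS yS xS' yS' exy exy' un p q hp hq.
have [a [b [aS bS eab pab Hab]]] := on _ _ _ xS yS exy hp.
have [a' [b' [aS' bS' eab' pab' Hab']]] := on _ _ _ xS' yS' exy' hq.
apply: (Hfar _ _ _ _ aS bS aS' bS' eab eab' _ p q pab pab').
have ne c c' : c \in [:: a; b] -> c' \in [:: a'; b'] -> c != c'.
  move=> /Hab H /Hab' H'; move: xS yS xS' yS' un H H'; rewrite !inE /= !inE !negb_or.
  move=> /andP[x1 _] /andP[x2 _] /andP[x3 _] /andP[x4 _].
  case/and4P=> /and3P[n1 n2 n3] /andP[n4 n5] n6 _ H H'.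
  apply/eqP => E; subst c'.
  case: H => [/orP[/eqP E1|/eqP E1]|[E1 /orP[/eqP E3|/eqP E3]]];
  case: H' => [/orP[/eqP E2|/eqP E2]|[E2 /orP[/eqP E4|/eqP E4]]];
  move: n1 n2 n3 n4 n5 n6 x1 x2 x3 x4; rewrite -?E1 -?E2 -?E3 -?E4 ?eqxx ?E1 ?E2 ?E3 ?E4 ?eqxx //.
by rewrite /= !inE !negb_or (sgraph_neq ge eab) (sgraph_neq ge eab') !ne ?inE ?eqxx ?orbT.
Qed.

End WeakDrawing.

(** * Edge density *)

Section Density.
Import mathcomp.boot.fintype mathcomp.boot.finset.
Variables (R : realFieldType) (V : finType).
Implicit Types (S Z : {set V}) (e : rel V).

Definition nbh e S (x : V) : {set V} := [set y in S | e x y].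

Definition arcs e S : nat := (\sum_(x in S) #|nbh e S x|)%N.

Lemma weak_drawing_no_K33 S e (A B : {set V}) : weak_drawing R S e ->
  A \subset S -> B \subset S -> [disjoint A & B] -> (3 <= #|A|)%N -> (3 <= #|B|)%N ->
  ~ (forall a b, a \in A -> b \in B -> e a b).
Proof.
move=> wd /subsetP AS /subsetP BS dAB A3 B3 H.
have /set0Pn[x0 _] : A != set0 by rewrite -card_gt0; apply: leq_trans A3.
have nA i : (i < 3)%N -> nth x0 (enum A) i \in A.
  by move=> i3; rewrite -mem_enum mem_nth // -cardE (leq_trans i3).
have nB i : (i < 3)%N -> nth x0 (enum B) i \in B.
  by move=> i3; rewrite -mem_enum mem_nth // -cardE (leq_trans i3).
apply: (weak_drawing_K33_free (a := nth x0 (enum A)) (b := nth x0 (enum B)) wd).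
- by move=> i /nA/AS.
- by move=> i /nB/BS.
- move=> i j i3 j3 ij; rewrite nth_uniq ?enum_uniq // -cardE; exact: leq_trans A3.
- move=> i j i3 j3 ij; rewrite nth_uniq ?enum_uniq // -cardE; exact: leq_trans B3.
- move=> i j i3 j3; apply/eqP => E; have := nB j j3.
  by rewrite -E (disjointFr dAB) // nA.
- by move=> i j i3 j3; apply: H; [exact: nA|exact: nB].
Qed.

(** Contraction loses the edge [u v] and, for each common neighbour, one of two edges that become
    parallel; every lost edge counts twice in [arcs]. *)
Lemma arcs_contract S e u v : sgraph e -> u \in S -> v \in S -> e u v ->
  arcs e S = (arcs (edge_contract e u v) (S :\ v) + 2 * #|nbh e S u :&: nbh e S v|.+1)%N.
Proof.
move=> ge uS vS euv; have [irr sym] := ge; have uv := sgraph_neq ge euv.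
have evu : e v u by rewrite sym.
set S' := S :\ v; set e' := edge_contract e u v.
have uS' : u \in S' by rewrite !inE uv.
set T := nbh e S u :&: nbh e S v.
rewrite /arcs (big_setD1 v) //= (big_setD1 u) //= -/S' [in RHS](big_setD1 u) //=.
have D (X Y : {set V}) : (#|X :|: Y| + #|X :&: Y| = #|X| + #|Y|)%N.
  by rewrite cardsU subnK // (leq_trans (subset_leq_card (subsetIl X Y))) // leq_addr.
have Eu : (#|nbh e S v| + #|nbh e S u| = #|nbh e' S' u| + #|T| + 2)%N.
  have -> : nbh e' S' u = (nbh e S u :|: nbh e S v) :\ u :\ v.
    apply/setP => y; rewrite !inE /e' /edge_contract eqxx /= [u == y]eq_sym.
    have [->|yv] := eqVneq y v; rewrite ?andbF //=.
    have [->|yu] := eqVneq y u; rewrite ?andbF //=.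
    by rewrite orbF; case: (y \in S).
  rewrite -addnC -D -/T.
  rewrite (cardsD1 u (nbh e S u :|: _)) (cardsD1 v (_ :\ u)).
  rewrite !inE uS vS evu euv [v == u]eq_sym (negbTE uv) ?orbT /=; lia.
have Ex x : x \in S' :\ u -> (#|nbh e S x| = #|nbh e' S' x| + (x \in T))%N.
  rewrite !inE => /and3P[xu xv xS].
  rewrite (cardsD1 v (nbh e S x)) (cardsD1 u (nbh e S x :\ v)) (cardsD1 u (nbh e' S' x)).
  rewrite !inE uS vS uv xS /= (sym u x) (sym v x).
  have -> : nbh e' S' x :\ u = nbh e S x :\ v :\ u.
    apply/setP => y; rewrite !inE /e' /edge_contract (negbTE xu) /=.
    have [->|yu] := eqVneq y u; rewrite ?andbF //=.
    have [->|yv] := eqVneq y v; rewrite ?andbF //=.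
    have [->|yx] := eqVneq x y; rewrite /= ?orbF //.
    by rewrite (negbTE (irr y)) andbF.
  rewrite /e' /edge_contract xu eqxx (negbTE xu) /=.
  by case: (e x u); case: (e x v) => //=; lia.
rewrite addnA Eu (eq_bigr _ Ex) big_split /=.
suff -> : (\sum_(x in S' :\ u) (x \in T) = #|T|)%N by lia.
rewrite -sum1_card (big_setID T) /= [X in (_ + X)%N]big1; last first.
  by move=> x; rewrite !inE => /andP[/negbTE->].
rewrite addn0 big_mkcond [RHS]big_mkcond /=; apply: eq_bigr => x _.
rewrite !inE; case xS : (x \in S); rewrite ?andbF //=.
have [->|xu] := eqVneq x u; first by rewrite (negbTE (irr u)) andbF.
by have [->|xv] := eqVneq x v; rewrite ?(negbTE (irr v)) ?andbF //=; case: ifP => // ->.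
Qed.

(** Induction on [#|S|]: contracting an edge with fewer than [c] common neighbours costs at most
    [2 * c] arcs. *)
Lemma arcs_le_of_contract (c : nat) (Q : {set V} -> rel V -> Prop) :
  (forall S e u v, sgraph e -> Q S e -> u \in S -> v \in S -> e u v ->
     Q (S :\ v) (edge_contract e u v)) ->
  (forall S e u v, sgraph e -> Q S e -> u \in S -> v \in S -> e u v ->
     exists u' v', [/\ u' \in S, v' \in S, e u' v' & (#|nbh e S u' :&: nbh e S v'| < c)%N]) ->
  forall S e, sgraph e -> Q S e -> S != set0 -> (arcs e S <= 2 * c * #|S|.-1)%N.
Proof.
move=> Qc Qt S e; elim: {S}_.+1 {-2}S (ltnSn #|S|) e => // m IH S mS e ge QS S0.
case: (boolP [exists u in S, exists v in S, e u v]); last first.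
  move=> N; rewrite /arcs big1 // => x xS; apply/eqP; rewrite cards_eq0.
  apply/eqP/setP => y; rewrite !inE; apply/negbTE; move: N; apply: contra => /andP[yS exy].
  by apply/existsP; exists x; rewrite xS; apply/existsP; exists y; rewrite yS.
move=> /existsP[u0 /andP[u0S /existsP[v0 /andP[v0S e0]]]].
have [u [v [uS vS euv T]]] := Qt _ _ _ _ ge QS u0S v0S e0.
rewrite (arcs_contract ge uS vS euv).
have uv := sgraph_neq ge euv.
have SE : #|S| = #|S :\ v|.+1 by rewrite (cardsD1 v S) vS.
have S'0 : S :\ v != set0 by apply/set0Pn; exists u; rewrite !inE uv.
have c0 : (0 < #|S :\ v|)%N by rewrite card_gt0.
have := IH (S :\ v) _ _ (sgraph_contract u v ge) (Qc _ _ _ _ ge QS uS vS euv) S'0.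
rewrite SE in mS *; move=> /(_ mS); rewrite /=.
by move: c0; case: #|_ :\ _| => // k _ /=; nia.
Qed.

(** Passing to a neighbourhood raises the number [k] of common neighbours by one and contraction
    inside [S] preserves it; three of them over three vertices of [S] would be a K_{3,3}. *)
Definition apexed k S e := exists Z, [/\ #|Z| = k, [disjoint Z & S],
  (forall z x, z \in Z -> x \in S -> e z x) & weak_drawing R (Z :|: S) e].

Lemma apexed_contract k S e u v : sgraph e -> apexed k S e -> u \in S -> v \in S -> e u v ->
  apexed k (S :\ v) (edge_contract e u v).
Proof.
move=> ge [Z [Zk ZS eZ wd]] uS vS euv; exists Z; split=> //.
- by apply: disjointWr ZS; apply: subsetDl.
- move=> z x zZ; rewrite !inE => /andP[xv xS]; rewrite /edge_contract eZ // andbT.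
  by apply/eqP => zx; rewrite zx in zZ; rewrite (disjointFr ZS zZ) in xS.
have -> : Z :|: S :\ v = (Z :|: S) :\ v.
  apply/setP => x; rewrite !inE; have [->|] := eqVneq x v; rewrite //= orbF.
  by rewrite (disjointFl ZS vS).
by apply: weak_drawing_contract => //; rewrite inE ?uS ?vS orbT.
Qed.

Lemma apexed_nbh k S e u : sgraph e -> apexed k S e -> u \in S -> apexed k.+1 (nbh e S u) e.
Proof.
move=> ge [Z [Zk ZS eZ wd]] uS; exists (u |: Z); split.
- by rewrite cardsU1 Zk (disjointFl ZS uS).
- rewrite -setI_eq0; apply/eqP/setP => x; rewrite !inE.
  case: eqVneq => [->|_]; first by rewrite (negbTE (ge.1 u)) andbF.
  by case xZ : (x \in Z); rewrite // (disjointFr ZS xZ).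
- move=> z x; rewrite !inE => /orP[/eqP->|zZ] /andP[xS ux] //; exact: eZ.
apply: weak_drawing_sub wd; apply/subsetP => x; rewrite !inE.
by case/orP=> [/orP[/eqP->|->]|/andP[->]]; rewrite ?uS ?orbT.
Qed.

(** The two apexes and [v] against three neighbours of [v] would form a K_{3,3}. *)
Lemma apexed2_deg S e v : sgraph e -> apexed 2 S e -> v \in S -> (#|nbh e S v| < 3)%N.
Proof.
move=> ge aS vS; rewrite ltnNge; apply/negP => d3.
have [Z [Zk ZS eZ wd]] := apexed_nbh ge aS vS.
apply: (weak_drawing_no_K33 wd _ _ ZS _ d3 eZ); rewrite ?subsetUl ?subsetUr //.
by rewrite Zk.
Qed.

Lemma nbh_nbh e S u v : nbh e (nbh e S u) v = nbh e S u :&: nbh e S v.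
Proof. by apply/setP => x; rewrite !inE; case: (x \in S). Qed.

(** The common neighbours of [u] and [v] are the neighbours of [v] inside the neighbourhood of [u],
    which has two apexes; so every edge lies in at most two triangles. *)
Lemma apexed1_arcs S e : sgraph e -> apexed 1 S e -> S != set0 -> (arcs e S <= 6 * #|S|.-1)%N.
Proof.
apply: (@arcs_le_of_contract 3); first exact: apexed_contract.
move=> {}S {}e u v ge aS uS vS euv; exists u, v; split=> //.
rewrite -nbh_nbh; apply: apexed2_deg => //; last by rewrite !inE vS.
exact: apexed_nbh.
Qed.

(** If every edge had at least 6 common neighbours, the neighbourhood of a vertex would have all
    degrees at least 6, against the bound with one apex. *)
Lemma weak_drawing_arcs S e : sgraph e -> weak_drawing R S e -> S != set0 ->
  (arcs e S <= 12 * #|S|.-1)%N.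
Proof.
move=> ge wd; apply: (@arcs_le_of_contract 6 (apexed 0)) => //; first exact: apexed_contract.
  move=> {ge wd}S {}e u v ge aS uS vS euv; apply: contrapT => H.
  have := apexed1_arcs ge (apexed_nbh ge aS uS).
  have N0 : nbh e S u != set0 by apply/set0Pn; exists v; rewrite !inE vS.
  move=> /(_ N0); apply/negP; rewrite -ltnNge.
  have : (\sum_(x in nbh e S u) 6 <= arcs e (nbh e S u))%N.
    apply: leq_sum => x; rewrite !inE nbh_nbh => /andP[xS ux].
    by rewrite leqNgt; apply/negP => T; apply: H; exists u, x.
  move: N0; rewrite sum_nat_const -card_gt0; lia.
exists set0; split; rewrite ?cards0 ?set0U ?disjoints0 //; first by rewrite -setI_eq0 set0I.
by move=> z x; rewrite inE.
Qed.

Lemma weak_drawing_degenerate S e : sgraph e -> weak_drawing R S e -> S != set0 ->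
  exists2 x, x \in S & (#|nbh e S x| < 12)%N.
Proof.
move=> ge wd S0; apply: contrapT => H.
have := weak_drawing_arcs ge wd S0; apply/negP; rewrite -ltnNge.
have : (\sum_(x in S) 12 <= arcs e S)%N.
  by apply: leq_sum => x xS; rewrite leqNgt; apply/negP => h; apply: H; exists x.
move: S0; rewrite sum_nat_const -card_gt0; lia.
Qed.

End Density.

(** * Weak drawings of planar graphs *)

Section PlanarDrawing.
Import numFieldNormedType.Exports.
Local Open Scope classical_set_scope.
Variable R : realType.

(** The points reachable from [a] by [d]-chains in [A] form a nonempty subset that is open and
    closed in [A]. *)
Lemma connected_chain (A : set (R * R)) (d : R) (a b : R * R) : connected A -> 0 < d ->
  A a -> A b ->
  exists s, [/\ path (@nearby R d) a s, last a s = b & forall p, p \in s -> A p].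
Proof.
move=> cA d0 Aa Ab.
pose B := [set b | A b /\
  exists s, [/\ path (@nearby R d) a s, last a s = b & forall p, p \in s -> A p]].
have ballE (p q : R * R) : ball p d q <-> nearby d p q.
  by rewrite /nearby; split => [[h1 h2]|/andP[h1 h2]]; [apply/andP|]; split.
have step p q : B p -> A q -> ball p d q -> B q.
  move=> [Ap [s [ps ls sA]]] Aq /ballE pq; split=> //; exists (rcons s q); split.
  - by rewrite rcons_path ps ls.
  - by rewrite last_rcons.
  - by move=> r; rewrite mem_rcons inE => /orP[/eqP->|/sA].
suff : B = A by move=> BA; have : B b by [rewrite BA]; case.
apply: cA; first by exists a; split=> //; exists [::].
- exists (\bigcup_(p in B) interior (ball p d)).
    by apply: bigcup_open => p _; exact: open_interior.
  apply/seteqP; split=> [p Bp|p [Ap [q Bq /interior_subset qp]]].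
    by split; [case: Bp|exists p => //; exact: nbhsx_ballx].
  exact: step Bq Ap qp.
- exists (~` \bigcup_(p in A `\` B) interior (ball p d)).
    by apply: open_closedC; apply: bigcup_open => p _; exact: open_interior.
  apply/seteqP; split=> [p Bp|p [Ap np]].
    split; first by case: Bp.
    move=> [q [Aq nq] /interior_subset qp]; apply: nq; apply: step Bp Aq _.
    exact: ball_sym.
  apply: contrapT => nB; apply: np; exists p; first by split.
  exact: nbhsx_ballx.
Qed.

(** The set of differences is compact, hence closed, and misses the origin; so it misses a ball
    around it. *)
Lemma compact_disjoint_far (A B : set (R * R)) : compact A -> compact B ->
  (forall p, A p -> ~ B p) ->
  exists2 d : R, 0 < d & forall p q, A p -> B q -> far d p q.
Proof.
move=> cA cB AB.
pose f (x : (R * R) * (R * R)) := x.1 - x.2.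
have cf : {within A `*` B, continuous f}.
  by apply: continuous_subspaceT; exact: sub_continuous.
have /compact_closed cl := continuous_compact cf (compact_setX cA cB).
have {cl}/closed_openC op := cl (@norm_hausdorff _ _).
have n0 : (~` (f @` (A `*` B))) 0.
  move=> [[p q] [/= Ap Bq]] /subr0_eq /= pq; by apply: (AB p) => //; rewrite pq.
have /nbhs_ballP[d d0 H] := open_nbhs_nbhs (conj op n0).
exists d => // p q Ap Bq; rewrite /far leNgt [X in _ || X]leNgt -negb_and.
apply/negP => /andP[h1 h2].
apply: (H (p - q)); last by exists (p, q).
by split; rewrite /ball /= sub0r normrN.
Qed.

Lemma finite_family_lower_bound (I : finType) (P : I -> R -> Prop) :
  (forall i, exists2 d, 0 < d & P i d) ->
  (forall i d d', d' <= d -> P i d -> P i d') ->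
  exists2 d, 0 < d & forall i, P i d.
Proof.
move=> H mono.
have {}H i : exists d, 0 < d /\ P i d by have [d] := H i; exists d.
have {H}[f Hf] := choice H.
exists (\big[Num.min/1]_i f i).
  by elim/big_ind: _ => // [x y x0 y0|i _]; [rewrite lt_min x0|exact: (Hf i).1].
by move=> i; apply: mono (Hf i).2; rewrite (bigD1 i) //= ge_min lexx.
Qed.

(** Arcs of vertex-disjoint edges are disjoint compact sets, so one distance separates all such
    pairs; each arc is connected and can be replaced by a fine chain of its points. *)
Lemma planar_weak_drawing n (e : rel 'I_n) : (forall x, ~~ e x x) -> planar R e ->
  weak_drawing R [set: 'I_n]%SET e.
Proof.
move=> irr [pos [arc [ipos [Harc Hdis]]]].
pose im x y := arc x y @` `[(0:R), 1].
have im0 x y : e x y -> im x y (pos x).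
  by move=> /Harc[_ [<- _]]; exists 0 => //=; rewrite in_itv /= lexx ler01.
have im1 x y : e x y -> im x y (pos y).
  by move=> /Harc[_ [_ [<- _]]]; exists 1 => //=; rewrite in_itv /= lexx ler01.
have cim x y : e x y -> compact (im x y).
  by move=> /Harc[c _]; apply: continuous_compact => //; exact: segment_compact.
have kim x y : e x y -> connected (im x y).
  by move=> /Harc[c _]; apply: connected_continuous_connected => //; exact: segment_connected.
have cases x y p : e x y -> im x y p ->
    [\/ p = pos x, p = pos y | exists2 s, 0 < s < 1 & p = arc x y s].
  move=> exy [s]; rewrite /= in_itv /= => /andP[s0 s1] <-.
  have [_ [a0 [a1 _]]] := Harc _ _ exy.
  have [->|sn0] := eqVneq s 0; first by constructor 1.
  have [->|sn1] := eqVneq s 1; first by constructor 2.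
  by constructor 3; exists s => //; rewrite !lt_neqAle s0 s1 eq_sym sn0 sn1.
have nopos x y s z : e x y -> 0 < s < 1 -> arc x y s <> pos z.
  by move=> /Harc[_ [_ [_ [_ H]]]]; exact: H.
have dis x y u v p : e x y -> e u v -> uniq [:: x; y; u; v] -> im x y p -> ~ im u v p.
  rewrite /= !inE !negb_or => exy euv /and4P[/and3P[xy xu xv] /andP[yu yv] uv _].
  move=> /(cases _ _ _ exy) hp /(cases _ _ _ euv) hq.
  case: hp => [E1|E1|[s s01 E1]]; case: hq => [E2|E2|[t t01 E2]]; rewrite E1 in E2.
  - by move/ipos: E2 => E2; rewrite E2 eqxx in xu.
  - by move/ipos: E2 => E2; rewrite E2 eqxx in xv.
  - exact: nopos (esym E2).
  - by move/ipos: E2 => E2; rewrite E2 eqxx in yu.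
  - by move/ipos: E2 => E2; rewrite E2 eqxx in yv.
  - exact: nopos (esym E2).
  - exact: nopos E2.
  - exact: nopos E2.
  - by have := Hdis _ _ _ _ _ _ exy euv s01 t01 E2; rewrite (negbTE xu) (negbTE xv).
pose P (i : ('I_n * 'I_n) * ('I_n * 'I_n)) d := let: ((x, y), (u, v)) := i in
  e x y -> e u v -> uniq [:: x; y; u; v] ->
  forall p q, im x y p -> im u v q -> far d p q.
have [d d0 Hd] : exists2 d, 0 < d & forall i, P i d.
  apply: finite_family_lower_bound.
    move=> [[x y] [u v]]; rewrite /P.
    case exy : (e x y); last by exists 1.
    case euv : (e u v); last by exists 1.
    case un : (uniq [:: x; y; u; v]); last by exists 1.
    have [d d0 H] := compact_disjoint_far (cim _ _ exy) (cim _ _ euv)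
      (fun p => dis _ _ _ _ p exy euv un).
    by exists d.
  move=> [[x y] [u v]] d d' dd H exy euv un p q hp hq; have := H exy euv un p q hp hq.
  by rewrite /far => /orP[h|h]; rewrite (le_trans dd h) ?orbT.
(* The chains are twice as fine as the separation, because a weak drawing compares steps [d] with
   distances [2 * d]. *)
have d20 : 0 < d / 2 by rewrite divr_gt0.
have ch x y : exists s, e x y -> [/\ path (@nearby R (d / 2)) (pos x) s, last (pos x) s = pos y &
    forall p, p \in s -> im x y p].
  case exy : (e x y); last by exists [::].
  have [s Hs] := connected_chain (kim _ _ exy) d20 (im0 _ _ exy) (im1 _ _ exy).
  by exists s.
have [c Hc] := choice (fun xy : 'I_n * 'I_n => ch xy.1 xy.2).
exists (d / 2), pos, (fun x y => c (x, y)); split=> //.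
  by move=> x y _ _ /(Hc (x, y))[].
move=> x y u v _ _ _ _ exy euv un p q hp hq.
have onim x' y' p' : e x' y' -> p' \in pos x' :: c (x', y') -> im x' y' p'.
  move=> h; rewrite inE => /orP[/eqP->|]; first exact: im0.
  by have [_ _] := Hc (x', y') h; exact.
have -> : 2 * (d / 2) = d by rewrite mulrC divfK // pnatr_eq0.
exact: (Hd ((x, y), (u, v)) exy euv un p q (onim _ _ _ exy hp) (onim _ _ _ euv hq)).
Qed.

End PlanarDrawing.

(** * Counting 2-walks *)

Section TwoWalks.
Import mathcomp.boot.fintype mathcomp.boot.finset.
Variables (R : realFieldType) (V : finType) (e : rel V).
Hypotheses (ge : sgraph e) (wd : weak_drawing R [set: V] e).

Local Notation N v := (nbh e [set: V] v).

Lemma in_nbhT u v : (u \in N v) = e v u.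
Proof. by rewrite !inE. Qed.

Lemma nbhI S u : nbh e S u = S :&: N u.
Proof. by apply/setP => w; rewrite !inE. Qed.

Lemma arcs_le (S : {set V}) : (arcs e S <= 12 * #|S|)%N.
Proof.
have [->|S0] := eqVneq S set0; first by rewrite /arcs big_set0.
apply: leq_trans (weak_drawing_arcs ge (weak_drawing_sub (subsetT S) wd) S0) _.
by rewrite leq_mul2l leq_pred orbT.
Qed.

(** Every pair counted is an arc inside [P :|: Q]. *)
Lemma sum_nbh_le (P Q : {set V}) : (\sum_(u in P) #|nbh e Q u| <= 12 * (#|P| + #|Q|))%N.
Proof.
apply: (@leq_trans (arcs e (P :|: Q))); last first.
  by apply: leq_trans (arcs_le _) _; rewrite leq_mul2l leq_card_setU orbT.
rewrite /arcs [leqRHS](big_setID P) /= setUK; apply: leq_trans (leq_addr _ _).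
apply: leq_sum => u _; apply: subset_leq_card.
by rewrite nbhI [nbh e (_ :|: _) u]nbhI setSI // subsetUr.
Qed.

Lemma sum_deg_le (P : {set V}) : (\sum_(u in P) #|N u| <= 12 * #|V|)%N.
Proof.
apply: (@leq_trans (arcs e setT)); last by apply: leq_trans (arcs_le _) _; rewrite cardsT.
by rewrite /arcs [X in (_ <= X)%N](big_setID P) /= setTI leq_addr.
Qed.

Lemma codeg3_le p q r : p != q -> p != r -> q != r -> (#|N p :&: N q :&: N r| <= 2)%N.
Proof.
move=> pq pr qr; rewrite leqNgt; apply/negP => h.
apply: (weak_drawing_no_K33 wd (subsetT [set p; q; r]) (subsetT _) _ _ h).
- rewrite -setI_eq0; apply/eqP/setP => x; rewrite !inE.
  by apply/negP => /andP[/orP[/orP[]|] /eqP->]; rewrite (negbTE (ge.1 _)) ?andbF.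
- by rewrite -setUA !cardsU1 cards1 !inE !negb_or pq pr qr.
- by move=> a b; rewrite !inE => /orP[/orP[]|] /eqP-> /andP[/andP[]].
Qed.

(** A vertex with [d] neighbours in [L] satisfies [d <= 1 + d * (d - 1)], and the product counts
    ordered pairs in [L]. Each such pair has, together with [v], at most two common neighbours. *)
Lemma sum_nbh_pairs_le v (L : {set V}) : v \notin L ->
  (\sum_(u in N v) #|nbh e L u| <= #|N v| + 2 * (#|L| * #|L|))%N.
Proof.
move=> vL.
have k1 u : (#|nbh e L u| <= 1 + \sum_(w in L | e u w) \sum_(w' in L :\ w | e u w') 1)%N.
  have -> : (\sum_(w in L | e u w) \sum_(w' in L :\ w | e u w') 1 =
      #|nbh e L u| * #|nbh e L u|.-1)%N.
    rewrite -sum_nat_const [RHS](eq_bigl (fun w => (w \in L) && e u w)) /=; last first.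
      by move=> w; rewrite !inE.
    apply: eq_bigr => w /andP[wL uw]; rewrite sum1dep_card (cardsD1 w (nbh e L u)) !inE wL uw /=.
    by apply: eq_card => w'; rewrite !inE andbA.
  by case: #|_| => [|[|k]] //=; nia.
apply: (@leq_trans (\sum_(u in N v) (1 + \sum_(w in L | e u w) \sum_(w' in L :\ w | e u w') 1))%N).
  by apply: leq_sum => u _; exact: k1.
rewrite big_split /= sum1_card leq_add2l.
apply: (@leq_trans (\sum_(w in L) \sum_(w' in L :\ w) 2)%N); last first.
  rewrite mulnCA -sum_nat_const; apply: leq_sum => w wL.
  by rewrite sum_nat_const mulnC leq_mul2l subset_leq_card // subsetDl.
under eq_bigr => u _ do rewrite big_mkcondr.
rewrite exchange_big /=; apply: leq_sum => w wL.
rewrite -big_mkcondr /=.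
under eq_bigr => u _ do rewrite big_mkcondr.
rewrite exchange_big /=; apply: leq_sum => w'; rewrite !inE => /andP[w'w w'L].
rewrite -big_mkcondr /= sum1dep_card.
have vw : v != w by apply: contraNneq vL => ->.
have vw' : v != w' by apply: contraNneq vL => ->.
apply: leq_trans (codeg3_le vw vw' _); last by rewrite eq_sym.
by apply: subset_leq_card; apply/subsetP => u; rewrite !inE !(ge.2 u).
Qed.

Variables (x : V -> R) (lam : R).
Hypotheses (x1 : forall v, x v <= 1) (lam0 : 0 < lam)
  (lamx : forall v, lam * x v <= \sum_(u in N v) x u).

Lemma two_walks v : lam ^+ 2 * x v <= \sum_(u in N v) \sum_(w in N u) x w.
Proof.
rewrite expr2 -mulrA; apply: le_trans (ler_wpM2l (ltW lam0) (lamx v)) _.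
by rewrite mulr_sumr; apply: ler_sum => u _; exact: lamx.
Qed.

(** Each vertex of the level set has degree at least [lam * t], and the degrees sum to at most
    [12 * #|V|]. *)
Lemma card_level (t : R) : t * lam * #|[set v | t <= x v]|%:R <= 12 * #|V|%:R.
Proof.
apply: (@le_trans _ _ (\sum_(v in [set v | t <= x v]) \sum_(u in N v) x u)).
  rewrite mulr_natr -sumr_const; apply: ler_sum => v; rewrite inE => tv.
  by apply: le_trans (lamx v); rewrite mulrC ler_wpM2l // ltW.
apply: (@le_trans _ _ (\sum_(v in [set v | t <= x v]) #|N v|%:R)).
  by apply: ler_sum => v _; rewrite -sumr_const; apply: ler_sum => u _.
by rewrite -natr_sum -natrM ler_nat sum_deg_le.
Qed.

(** The 2-walks ending below level [t] number at most the total degree and weigh at most [t]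
    each. *)
Lemma two_walks_level v (t : R) : 0 <= t ->
  lam ^+ 2 * x v <= 12 * #|V|%:R * t +
    \sum_(u in N v) \sum_(w in nbh e [set w | t <= x w] u) x w.
Proof.
move=> t0; apply: le_trans (two_walks v) _.
apply: (@le_trans _ _ (\sum_(u in N v) (t *+ #|N u| +
  \sum_(w in nbh e [set w | t <= x w] u) x w))); last first.
  rewrite big_split /= lerD2r sumrMnr -[t *+ _]mulr_natl ler_wpM2r //.
  by rewrite -natrM ler_nat sum_deg_le.
apply: ler_sum => u _; rewrite (big_setID [set w | t <= x w]) /= addrC.
rewrite setIC -nbhI lerD2r -sumr_const.
rewrite big_mkcond [leRHS]big_mkcond /=; apply: ler_sum => w _.
by rewrite !inE -ltNge; case: (e u w); rewrite ?andbF //= andbT; case: ltP => // /ltW.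
Qed.

End TwoWalks.

(** * Two vertices with large entries *)

Section LargeVertices.
Import mathcomp.boot.fintype mathcomp.boot.finset.
Variables (R : realFieldType) (V : finType) (e : rel V).
Hypotheses (ge : sgraph e) (wd : weak_drawing R [set: V] e).
Variables (x : V -> R) (lam nV : R).
Hypotheses (x0 : forall v, 0 <= x v) (x1 : forall v, x v <= 1) (lam0 : 0 < lam)
  (lamx : forall v, lam * x v <= \sum_(u in nbh e [set: V] v) x u)
  (nVE : nV = #|V|%:R) (cardV : 216 * 10 ^+ 15 <= nV)
  (lamE : lam ^+ 2 = lam + 2 * (nV - 2)).

Local Notation N v := (nbh e [set: V] v).

(** The square of the constant is 4.225e17, while [lam ^+ 2] is about 4.32e17 or more. *)
Lemma lam_lb : 65 * 10 ^+ 7 <= lam.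
Proof.
rewrite leNgt; apply/negP => h.
have : lam * lam <= (65 * 10 ^+ 7) * (65 * 10 ^+ 7).
  by apply: ler_pM; rewrite ?ltW.
by move: lamE cardV lam0; rewrite expr2 => *; lra.
Qed.

Lemma lam_sq_lb : 2 * nV <= lam ^+ 2.
Proof. by rewrite lamE; move: lam_lb => *; lra. Qed.

Definition heavy := [set v | 500^-1 <= x v].

Lemma heavy_deg v : v \in heavy -> nV / (2 * 10 ^+ 4) <= #|N v|%:R.
Proof.
rewrite inE => hv.
(* With cutoff 1/6000 the light 2-walks weigh at most [0.002 * nV], half of the lower bound
   [2 * nV / 500]. The other half is at most 12 times the sum of [#|N v|] and [#|S|], where [#|S|]
   is below [0.00012 * nV]. *)
set S := [set v | (6 * 10 ^+ 3)^-1 <= x v].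
have hS : 65 * 10 ^+ 7 * #|S|%:R <= (72 * 10 ^+ 3) * nV.
  have := card_level ge wd x1 lam0 lamx (6 * 10 ^+ 3)^-1; rewrite -/S -nVE.
  have := ler_wpM2r (ler0n R #|S|) lam_lb.
  move=> h1 h2; apply: le_trans h1 _; lra.
have h2 : \sum_(u in N v) \sum_(w in nbh e S u) x w <= 12 * (#|N v|%:R + #|S|%:R).
  rewrite -natrD -natrM; apply: (@le_trans _ _ (\sum_(u in N v) #|nbh e S u|)%:R).
    rewrite natr_sum; apply: ler_sum => u _.
    by rewrite -sumr_const; apply: ler_sum => w _.
  by rewrite ler_nat (sum_nbh_le ge wd).
have t0 : 0 <= (6 * 10 ^+ 3)^-1 :> R by rewrite invr_ge0 mulr_ge0 // exprn_ge0.
have h3 := two_walks_level ge wd lam0 lamx v t0; rewrite -/S -nVE in h3.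
have h4 : 2 * nV * 500^-1 <= lam ^+ 2 * x v.
  by apply: ler_pM lam_sq_lb hv; rewrite ?invr_ge0 ?ler0n // mulr_ge0 // nVE.
have n0 : 0 <= nV by rewrite nVE.
lra.
Qed.

(** The total degree [12 * nV] divided by the least degree [nV / 20000] of a heavy vertex. *)
Lemma heavy_card : #|heavy|%:R <= (24 * 10 ^+ 4) :> R.
Proof.
have h : nV / (2 * 10 ^+ 4) * #|heavy|%:R <= 12 * nV.
  rewrite mulr_natr -sumr_const [in leRHS]nVE -natrM.
  apply: le_trans (_ : (\sum_(v in heavy) #|N v|)%:R <= _); last first.
    by rewrite ler_nat (sum_deg_le ge wd).
  by rewrite natr_sum; apply: ler_sum => v; exact: heavy_deg.
have n0 : 0 < nV by apply: lt_le_trans cardV; rewrite mulr_gt0 // exprn_gt0.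
have {}h : nV * #|heavy|%:R <= nV * (24 * 10 ^+ 4) by lra.
by rewrite ler_pM2l in h.
Qed.

(** The three terms bound the 2-walks from [v] that end at light vertices, at [v] itself, and at
    other heavy vertices. For the last, twice the square of 240000 is below [nV / 10 ^+ 6]. *)
Lemma two_walks_deg v (b : R) : 0 <= b -> (forall w, w != v -> x w <= b) ->
  lam ^+ 2 * x v <= (12 / 500) * nV + #|N v|%:R + b * (#|N v|%:R + nV / 10 ^+ 6).
Proof.
move=> b0 xb.
have t0 : 0 <= 500^-1 :> R by rewrite invr_ge0 ler0n.
apply: le_trans (two_walks_level ge wd lam0 lamx v t0) _; rewrite -/heavy -addrA.
apply: lerD; first by rewrite -nVE mulrAC.
set L := heavy :\ v.
apply: (@le_trans _ _ (\sum_(u in N v) (1 + b *+ #|nbh e L u|))).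
  apply: ler_sum => u _.
  rewrite (big_setID [set v]) /=; apply: lerD.
    apply: (@le_trans _ _ (\sum_(w in [set v]) x w)); last by rewrite big_set1.
    rewrite big_mkcond [leRHS]big_mkcond /=; apply: ler_sum => w _; rewrite !inE.
    by case: (w == v); rewrite ?andbF ?andbT //; case: ifP.
  rewrite -sumr_const.
  have -> : nbh e heavy u :\: [set v] = nbh e L u.
    by apply/setP => w; rewrite !inE andbA.
  by apply: ler_sum => w; rewrite !inE => /andP[/andP[wv _] _]; exact: xb.
rewrite big_split /= sumr_const lerD2l sumrMnr -[b *+ _]mulr_natr ler_wpM2l //.
apply: (@le_trans _ _ (#|N v| + 2 * (#|L| * #|L|))%:R).
  by rewrite ler_nat (sum_nbh_pairs_le ge wd) // !inE eqxx.
rewrite natrD lerD2l natrM natrM.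
set l : R := #|L|%:R.
have hL : l <= (24 * 10 ^+ 4).
  by apply: le_trans heavy_card; rewrite ler_nat subset_leq_card // subsetDl.
have : l * l <= (24 * 10 ^+ 4) * (24 * 10 ^+ 4) by apply: ler_pM.
by move: cardV => *; lra.
Qed.

(** The previous bound with [b = 1], halved by means of [2 * nV <= lam ^+ 2]. *)
Lemma entry_le_deg v : nV * x v <= (121 / 10 ^+ 4) * nV + #|N v|%:R.
Proof.
have h1 := two_walks_deg (v := v) ler01 (fun w _ => x1 w).
have h2 := ler_wpM2r (x0 v) lam_sq_lb.
by move: cardV => *; lra.
Qed.

(** Otherwise the bound with [b = 0.97] gives less than [2 * nV], namely about
    [(0.024 + 1 + 0.97) * nV]. *)
Lemma second_vertex z : x z = 1 -> exists2 z', z' != z & 97 / 100 <= x z'.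
Proof.
move=> xz; apply: contrapT => H.
have b0 : 0 <= 97 / 100 :> R by rewrite divr_ge0.
have xb w : w != z -> x w <= 97 / 100.
  by move=> wz; rewrite leNgt; apply/negP => h; apply: H; exists w => //; exact: ltW.
have := two_walks_deg b0 xb;  rewrite xz mulr1 => h'.
have h : #|N z|%:R <= nV by rewrite nVE ler_nat max_card.
by move: lam_sq_lb cardV => *; lra.
Qed.

End LargeVertices.

(** * The quadratic form of the adjacency matrix *)

Section AdjacencyForm.
Import mathcomp.boot.fintype mathcomp.boot.finset.
Variables (R : realFieldType) (V : finType) (e : rel V).
Hypotheses (ge : sgraph e) (wd : weak_drawing R [set: V] e).
Variable x : V -> R.
Hypothesis x0 : forall v, 0 <= x v.
Implicit Types S T U : {set V}.

Lemma sum_disjointU S T (F : V -> R) : [disjoint S & T] ->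
  \sum_(u in S :|: T) F u = \sum_(u in S) F u + \sum_(u in T) F u.
Proof.
move=> dST; rewrite (big_setID S) /= setUK setDUl setDv set0U.
congr (_ + _); apply: eq_bigl => u; rewrite inE andbC.
by case: (boolP (u \in T)) => // /(disjointFl dST)->.
Qed.

Definition adj_form S T : R := \sum_(u in S) \sum_(v in T) (e u v)%:R * (x u * x v).

Lemma adj_formC S T : adj_form S T = adj_form T S.
Proof.
rewrite /adj_form exchange_big /=; apply: eq_bigr => u _; apply: eq_bigr => v _.
by rewrite ge.2 [x v * _]mulrC.
Qed.

Lemma adj_formUl S T U : [disjoint S & T] -> adj_form (S :|: T) U = adj_form S U + adj_form T U.
Proof. by move=> dST; rewrite /adj_form sum_disjointU. Qed.

Lemma adj_formUr S T U : [disjoint S & T] -> adj_form U (S :|: T) = adj_form U S + adj_form U T.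
Proof. by move=> dST; rewrite ![adj_form U _]adj_formC adj_formUl. Qed.

Lemma adj_form1E u T : adj_form [set u] T = x u * \sum_(v in nbh e T u) x v.
Proof.
rewrite /adj_form big_set1 mulr_sumr big_mkcond [RHS]big_mkcond /=; apply: eq_bigr => v _.
by rewrite !inE; case: (v \in T); case: (e u v); rewrite //= ?mul1r ?mul0r.
Qed.

Lemma adj_form_ge0 S T : 0 <= adj_form S T.
Proof. by apply: sumr_ge0 => u _; apply: sumr_ge0 => v _; rewrite !mulr_ge0. Qed.

Lemma adj_form_le_deg (k : nat) (h : R) S T : (forall v, v \in T -> x v <= h) -> 0 <= h ->
  (forall u, u \in S -> (#|nbh e T u| <= k)%N) ->
  adj_form S T <= k%:R * h * \sum_(u in S) x u.
Proof.
move=> xh h0 kS; rewrite mulr_sumr; apply: ler_sum => u uS.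
have := adj_form1E u T; rewrite /adj_form big_set1 => ->.
rewrite mulrC ler_wpM2r //; apply: (@le_trans _ _ (\sum_(v in nbh e T u) h)).
  by apply: ler_sum => v; rewrite !inE => /andP[/xh].
by rewrite sumr_const -[h *+ _]mulr_natl ler_wpM2r // ler_nat kS.
Qed.

(** Vertices of degree at most 11 are removed one by one; each edge is counted twice in the form,
    whence 22. *)
Lemma adj_form_degenerate (h : R) S : (forall v, v \in S -> x v <= h) -> 0 <= h ->
  adj_form S S <= 22 * h * \sum_(u in S) x u.
Proof.
move=> + h0; elim: {S}_.+1 {-2}S (ltnSn #|S|) => // m IH S mS xh.
have [->|S0] := eqVneq S set0; first by rewrite /adj_form !big_set0 mulr0.
have [v vS dv] := weak_drawing_degenerate ge (weak_drawing_sub (subsetT S) wd) S0.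
have dis : [disjoint [set v] & S :\ v].
  by rewrite -setI_eq0; apply/eqP/setP => w; rewrite !inE; case: eqP.
have -> : S = [set v] :|: S :\ v by rewrite setD1K.
rewrite adj_formUl // !adj_formUr // [adj_form (S :\ v) [set v]]adj_formC.
rewrite sum_disjointU //= big_set1.
have vv : adj_form [set v] [set v] = 0.
  by rewrite /adj_form !big_set1 (negbTE (ge.1 v)) mul0r.
have vS' : adj_form [set v] (S :\ v) <= 11 * h * x v.
  have := @adj_form_le_deg 11 h [set v] (S :\ v); rewrite big_set1; apply=> //.
    by move=> w; rewrite !inE => /andP[_ /xh].
  move=> w; rewrite inE => /eqP->; rewrite -ltnS; apply: leq_ltn_trans dv.
  by apply: subset_leq_card; apply/subsetP => y; rewrite !inE => /andP[/andP[_ ->]].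
have IH' : adj_form (S :\ v) (S :\ v) <= 22 * h * \sum_(u in S :\ v) x u.
  apply: IH; first by rewrite (cardsD1 v S) vS in mS.
  by move=> w; rewrite !inE => /andP[_ /xh].
rewrite vv; lra.
Qed.

End AdjacencyForm.

(** * Structure around the two large vertices *)

Definition C33_free (V : finType) (e : rel V) := forall v a b c d,
  uniq [:: v; a; b; c; d] -> e v a -> e v b -> e a b -> e v c -> e v d -> ~~ e c d.

Section Structure.
Import mathcomp.boot.fintype mathcomp.boot.finset.
Variables (R : realFieldType) (V : finType) (e : rel V).
Hypotheses (ge : sgraph e) (wd : weak_drawing R [set: V] e) (c33 : C33_free e).
Variables (x : V -> R) (lam nV : R).
Hypotheses (x0 : forall v, 0 <= x v) (x1 : forall v, x v <= 1) (lam0 : 0 < lam)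
  (lamx : forall v, lam * x v <= \sum_(u in nbh e [set: V] v) x u)
  (nVE : nV = #|V|%:R) (cardV : 216 * 10 ^+ 15 <= nV)
  (lamE : lam ^+ 2 = lam + 2 * (nV - 2)).
Variables (z z' : V).
Hypotheses (xz : x z = 1) (zz' : z' != z) (xz' : 97 / 100 <= x z').

Local Notation N v := (nbh e [set: V] v).
Local Notation A := (N z :&: N z').
Local Notation D := (~: ([set z; z'] :|: A)).

(** The degrees of [z] and [z'] are at least 0.9879 and 0.9579 times [nV], so inclusion-exclusion
    applies. *)
Lemma card_common : (945 / 1000) * nV <= #|A|%:R.
Proof.
have h1 := entry_le_deg ge wd x0 x1 lam0 lamx nVE cardV lamE z.
have h2 := entry_le_deg ge wd x0 x1 lam0 lamx nVE cardV lamE z'.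
have n0 : 0 <= nV by rewrite nVE.
have h3 := ler_wpM2l n0 xz'.
rewrite xz mulr1 in h1.
have h4 : #|N z|%:R + #|N z'|%:R <= #|A|%:R + nV.
  by rewrite nVE -!natrD ler_nat -cardsUI [leqRHS]addnC leq_add2r max_card.
by move: cardV => *; lra.
Qed.

Lemma nbh_common_le b : b != z -> b != z' -> (#|nbh e A b| <= 2)%N.
Proof.
move=> bz bz'; rewrite nbhI; apply: (codeg3_le ge wd); rewrite // eq_sym //.
Qed.

(** At most two neighbours of [b] lie in [A], so its degree is at most [0.055 * nV + 2]. *)
Lemma light_entry b : b != z -> b != z' -> x b <= 7 / 100.
Proof.
move=> bz bz'.
have h1 := entry_le_deg ge wd x0 x1 lam0 lamx nVE cardV lamE b.
have h2 := card_common.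
have h3 : #|N b|%:R + #|A|%:R <= 2 + nV.
  rewrite nVE -!natrD ler_nat -cardsUI addnC; apply: leq_add; last by rewrite max_card.
  by rewrite setIC -nbhI nbh_common_le.
have n0 : 0 < nV by apply: lt_le_trans cardV; rewrite mulr_gt0 // exprn_gt0.
rewrite -(ler_pM2l n0); move: cardV => *; lra.
Qed.

Lemma common_has_third (a b : V) : exists2 c, c \in A & (c != a) && (c != b).
Proof.
apply: contrapT => H.
have : #|A|%:R <= 2 :> R.
  rewrite ler_nat; apply: leq_trans (_ : #|[set a; b]| <= 2)%N; last first.
    by rewrite cards2; case: (_ != _).
  apply: subset_leq_card; apply/subsetP => c cA; rewrite !inE.
  by apply/negPn/negP; rewrite negb_or => h; apply: H; exists c.
by move: card_common cardV => *; lra.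
Qed.

(** An edge [a b] would give a triangle at [z] that shares only [z] with a triangle [z z' c], where
    [c] is another common neighbour. *)
Lemma common_independent a b : e z z' -> e z a -> e z b -> a != z' -> b != z' -> ~~ e a b.
Proof.
move=> ezz eza ezb az' bz'; apply/negP => eab.
have [c] := common_has_third a b; rewrite !inE /= => /andP[zc zc'] /andP[ca cb].
have := c33 (v := z) (a := a) (b := b) (c := z') (d := c); rewrite eza ezb eab ezz zc zc' /=.
rewrite !inE !negb_or (sgraph_neq ge eza) (sgraph_neq ge ezb) (sgraph_neq ge ezz)
  (sgraph_neq ge zc) (sgraph_neq ge zc').
rewrite (sgraph_neq ge eab) az' bz' ![_ == c]eq_sym ca cb /=.
by move=> /(_ isT isT isT isT isT isT).
Qed.

Lemma sum_sq_le_form : lam * \sum_v x v ^+ 2 <= adj_form e x [set: V] [set: V].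
Proof.
rewrite mulr_sumr /adj_form; rewrite [leRHS](eq_bigl xpredT) /=; last by move=> v; rewrite inE.
apply: ler_sum => v _; rewrite expr2 mulrA.
apply: le_trans (ler_wpM2r (x0 v) (lamx v)) _.
rewrite mulr_suml big_mkcond [leRHS]big_mkcond /=; apply: ler_sum => u _.
by rewrite !inE; case: (e v u); rewrite ?mul1r ?mul0r // mulrC.
Qed.

Lemma form_common_le : adj_form e x A A <= if e z z' then 0 else 1 / 10.
Proof.
have nz a : a \in A -> a != z /\ a != z'.
  by rewrite !inE => /andP[h1 h2]; split; apply/eqP => E; move: h1 h2; rewrite E !(negbTE (ge.1 _)).
have xA a : a \in A -> x a <= 7 / 100 by move=> /nz[h1 h2]; exact: light_entry.
have h0 : 0 <= 7 / 100 :> R by rewrite divr_ge0.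
case: (boolP [exists a in A, exists b in A, e a b]); last first.
  move=> H; rewrite /adj_form big1; first by case: ifP => // _; rewrite divr_ge0.
  move=> a aA; rewrite big1 // => b bA; case eab : (e a b); last by rewrite mul0r.
  by case/negP: H; apply/existsP; exists a; rewrite aA; apply/existsP; exists b; rewrite bA.
move=> /existsP[a /andP[aA /existsP[b /andP[bA eab]]]].
have zA v : v \in A -> e z v by rewrite !inE => /andP[].
case: ifP => [ezz|_].
  by have := common_independent ezz (zA a aA) (zA b bA) (nz a aA).2 (nz b bA).2; rewrite eab.
(* Two disjoint edges inside [A] would form two triangles sharing only [z], so all edges in [A] meet
   one fixed edge [a b]. *)
have cov u v : u \in A -> v \in A -> e u v -> (u \in [set a; b]) || (v \in [set a; b]).
  move=> uA vA euv; apply: contraT; rewrite !inE !negb_or => /andP[/andP[ua ub] /andP[va vb]].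
  have := c33 (v := z) (a := a) (b := b) (c := u) (d := v).
  rewrite !zA // eab euv /= !inE !negb_or ![z == _]eq_sym
    (nz a aA).1 (nz b bA).1 (nz u uA).1 (nz v vA).1.
  rewrite (sgraph_neq ge eab) (sgraph_neq ge euv) ![_ == u]eq_sym ![_ == v]eq_sym ua ub va vb.
  by move=> /(_ isT isT isT isT isT isT).
set P := [set a; b]; set Q := A :\: P.
have PA : P \subset A.
  by apply/subsetP => u; rewrite !inE => /orP[] /eqP->; move: aA bA; rewrite !inE.
have dPQ : [disjoint P & Q] by rewrite -setI_eq0 setIDA setIC -setIDA setDv setI0.
have AE : A = P :|: Q by rewrite -{1}(setID A P) (setIidPr PA).
have QQ : adj_form e x Q Q = 0.
  rewrite /adj_form big1 // => u; rewrite in_setD => /andP[uP uA].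
  rewrite big1 // => v; rewrite in_setD => /andP[vP vA].
  case euv : (e u v); last by rewrite mul0r.
  by have := cov u v uA vA euv; rewrite (negbTE uP) (negbTE vP).
(* Both [a] and [b] have at most two neighbours in [A]; doubling [0.14 * (x a + x b)] stays below
   1/10. *)
have PA2 : adj_form e x P A <= 2%:R * (7 / 100) * \sum_(u in P) x u.
  apply: adj_form_le_deg => // u uP; have [] := nz u (subsetP PA u uP); exact: nbh_common_le.
have xP : \sum_(u in P) x u <= x a + x b.
  rewrite /P setUC; have [->|ab] := eqVneq a b; first by rewrite setUid big_set1 lerDl.
  by rewrite big_setU1 ?inE 1?eq_sym //= big_set1 addrC.
have ha := xA a aA; have hb := xA b bA.
have PP := adj_form_ge0 e x0 P P.
rewrite {1 2}AE (adj_formUl e x _ dPQ) !(adj_formUr ge x _ dPQ) QQ (adj_formC ge x Q P).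
by move: PA2; rewrite AE (adj_formUr ge x _ dPQ) => *; lra.
Qed.

Lemma common_disjoint : [disjoint [set z; z'] & A].
Proof.
rewrite -setI_eq0; apply/eqP/setP => u; rewrite !inE.
by apply/negP => /andP[/orP[] /eqP->]; rewrite !(negbTE (ge.1 _)) ?andbF.
Qed.

Lemma common_rest_disjoint : [disjoint A & D].
Proof.
rewrite -setI_eq0; apply/eqP/setP => u; rewrite !inE.
by case: (e z u); case: (e z' u); rewrite ?orbT ?andbF.
Qed.

(** The coefficient is [2 * 0.14] for the edges between [D] and [A] plus [22 * 0.07] for those
    inside [D]. *)
Lemma form_rest_le : adj_form e x (A :|: D) (A :|: D) <=
  (if e z z' then 0 else 1 / 10) + 182 / 100 * \sum_(u in D) x u.
Proof.
have dAD := common_rest_disjoint.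
have nzD u : u \in D -> u != z /\ u != z' by rewrite !inE !negb_or => /andP[/andP[-> ->]].
have nzA u : u \in A -> u != z /\ u != z'.
  move=> uA; have := disjointFl common_disjoint uA; rewrite !inE.
  by move/negbT; rewrite negb_or => /andP[].
have h0 : 0 <= 7 / 100 :> R by rewrite divr_ge0.
have xA u : u \in A -> x u <= 7 / 100 by move=> /nzA[]; exact: light_entry.
have xD u : u \in D -> x u <= 7 / 100 by move=> /nzD[]; exact: light_entry.
rewrite (adj_formUl e x _ dAD) !(adj_formUr ge x _ dAD) (adj_formC ge x A D).
have h1 := form_common_le.
have h2 := adj_form_degenerate ge wd x0 xD h0.
have h3 : adj_form e x D A <= 2%:R * (7 / 100) * \sum_(u in D) x u.
  by apply: adj_form_le_deg => // u /nzD[]; exact: nbh_common_le.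
by move: h1; case: (e z z') => h1; lra.
Qed.

(** Each vertex of [D] misses [z] or [z'], whose entries are at least 0.97. Counted twice in the
    full form, this loss of 1.94 outweighs the 1.82 from the edges away from [z] and [z']. *)
Lemma form_cross_le : adj_form e x [set z; z'] (A :|: D) <=
  (x z + x z') * \sum_(u in A :|: D) x u - 97 / 100 * \sum_(u in D) x u.
Proof.
have dAD := common_rest_disjoint.
rewrite (adj_formUr ge x _ dAD) (sum_disjointU _ dAD).
have EU (T : {set V}) : adj_form e x [set z; z'] T =
    \sum_(u in T) ((e z u)%:R * x z + (e z' u)%:R * x z') * x u.
  rewrite adj_formC // /adj_form; apply: eq_bigr => u _.
  rewrite big_setU1 ?inE 1?eq_sym // big_set1 !(ge.2 u) /=; ring.
have hA : adj_form e x [set z; z'] A = (x z + x z') * \sum_(u in A) x u.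
  rewrite EU mulr_sumr; apply: eq_bigr => u; rewrite !inE => /andP[/= -> ->].
  by rewrite !mul1r.
have hD : adj_form e x [set z; z'] D <= (x z + x z' - 97 / 100) * \sum_(u in D) x u.
  rewrite EU mulr_sumr; apply: ler_sum => u; rewrite !inE !negb_or => /andP[_].
  have hz := x0 z; have hz' := xz'; have hz1 := xz.
  move=> /= nA; apply: ler_wpM2r => //; move: nA; rewrite xz.
  by case: (e z u); case: (e z' u) => //= _; lra.
lra.
Qed.

(** After completing squares, [sum_sq_le_form] bounds by zero a sum of nonnegative terms: the
    defects of [lam * x u = s], the eigenvector equation of K_2 + H(1,1) away from the pair, and the
    losses from missing edges. So all vanish. *)
Lemma dominating_pair : e z z' /\ forall b, b != z -> b != z' -> e z b /\ e z' b.
Proof.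
set B := A :|: D.
have dB : [disjoint [set z; z'] & B].
  rewrite -setI_eq0; apply/eqP/setP => u; rewrite in_setI in_set0; apply/negP => /andP[uz].
  by rewrite in_setU (disjointFr common_disjoint uz) in_setC in_setU uz.
have TE : [set: V] = [set z; z'] :|: B.
  apply/setP => u; rewrite [in RHS]in_setU [u \in B]in_setU in_setC.
  by rewrite [in X in _ || (_ || X)]in_setU in_setT orbA orbN.
have sumZ (F : V -> R) : \sum_(v in [set z; z']) F v = F z + F z'.
  by rewrite big_setU1 ?inE 1?eq_sym // big_set1.
have sumT (F : V -> R) : \sum_v F v = F z + F z' + \sum_(v in B) F v.
  rewrite (eq_bigl (fun v => v \in [set: V])); last by move=> v; rewrite in_setT.
  by rewrite TE (sum_disjointU _ dB) sumZ.
have cB : #|B|%:R = nV - 2.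
  have : #|[set: V]|%:R = \sum_(v : V) 1 :> R by rewrite sumr_const cardsT.
  by rewrite sumT sumr_const cardsT -nVE => h; lra.
have sq := sum_sq_le_form; rewrite sumT TE in sq.
rewrite (adj_formUl e x _ dB) !(adj_formUr ge x _ dB) (adj_formC ge x B) in sq.
have fzz : adj_form e x [set z; z'] [set z; z'] = 2 * (e z z')%:R * (x z * x z').
  rewrite /adj_form !sumZ !(negbTE (ge.1 _)) (ge.2 z' z) /=; ring.
have fc := form_cross_le; have fr := form_rest_le; rewrite -/B in fc fr.
set s := x z + x z' in fc *.
have YE : \sum_(u in B) (lam * x u - s) ^+ 2 =
    lam * (lam * \sum_(u in B) x u ^+ 2 - 2 * s * \sum_(u in B) x u) + (nV - 2) * s ^+ 2.
  rewrite -cB [_ * s ^+ 2]mulr_natl -sumr_const !mulr_sumr -sumrB mulr_sumr -big_split /=.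
  by apply: eq_bigr => u _; ring.
have Y0 : 0 <= \sum_(u in B) (lam * x u - s) ^+ 2 by apply: sumr_ge0 => u _; exact: sqr_ge0.
have X0 : 0 <= \sum_(u in D) x u by exact: sumr_ge0.
(* Without the edge [z z'] the form lacks [2 * x z * x z'], at least 1.94, and gains at most 1/10,
   so a defect of 1 is safe. *)
pose g : R := if e z z' then 0 else 1.
(* The coefficient 12/100 is the net loss 1.94 - 1.82 per unit of weight in [D]. *)
have key : \sum_(u in B) (lam * x u - s) ^+ 2 + lam * (12 / 100 * \sum_(u in D) x u + g) <= 0.
  have nE : 2 * (nV - 2) = lam ^+ 2 - lam by rewrite lamE; ring.
  have h1 : lam * (x z ^+ 2 + x z' ^+ 2) +
      (lam * \sum_(u in B) x u ^+ 2 - 2 * s * \sum_(u in B) x u)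
      - 2 * (x z * x z') <= - (12 / 100 * \sum_(u in D) x u + g).
    move: sq fr; rewrite fzz /g; move: xz' xz => hz' hz; rewrite !hz.
    by case: (e z z') => /= sq fr; lra.
  have h2 := ler_wpM2l (ltW lam0) h1.
  (* Half of this expression is what the terms in [z] and [z'] leave once the squares are completed
     and [2 * (nV - 2)] is replaced by [lam ^+ 2 - lam]. *)
  have h3 : 0 <= (lam ^+ 2 + lam) * (x z - x z') ^+ 2.
    by rewrite mulr_ge0 ?sqr_ge0 // addr_ge0 ?sqr_ge0 ?ltW.
  rewrite YE.
  have -> : (nV - 2) * s ^+ 2 = (lam ^+ 2 - lam) / 2 * s ^+ 2 by rewrite -nE; field.
  rewrite /s in h2 *; nra.
have g0 : 0 <= g by rewrite /g; case: (e z z').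
have YX : lam * (12 / 100 * \sum_(u in D) x u + g) <= 0 by lra.
rewrite pmulr_rle0 // in YX.
have {}g0 : e z z' by move: YX; rewrite /g; case: (e z z') => //=; lra.
have Y00 : \sum_(u in B) (lam * x u - s) ^+ 2 = 0.
  apply/eqP; rewrite eq_le Y0 andbT; move: key; rewrite /g g0.
  have := mulr_ge0 (ltW lam0) X0; lra.
have X00 : \sum_(u in D) x u = 0.
  by apply/eqP; rewrite eq_le X0 andbT; move: YX; rewrite /g g0; lra.
split=> // b bz bz'.
suff : b \notin D by rewrite !inE negbK (negbTE bz) (negbTE bz') /= => /andP[].
(* A vertex of [D] would have entry 0 and also entry [s / lam], which is positive. *)
apply/negP => bD.
have xb : x b = 0 by apply: (psumr_eq0P _ X00).
have : (lam * x b - s) ^+ 2 = 0.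
  have bB : b \in B by rewrite inE bD orbT.
  by apply: (psumr_eq0P _ Y00) => // u _; exact: sqr_ge0.
move/eqP; rewrite sqrf_eq0 xb mulr0 sub0r oppr_eq0 /s xz => /eqP h.
by have := x0 z'; rewrite -(lerD2l 1) addr0 h ler10.
Qed.

End Structure.

(** * Spectral radii *)

Section Spectrum.
Variables (R : realType) (n : nat).
Implicit Types (e : rel 'I_n).

(** Absolute values of an eigenvector, by the triangle inequality. *)
Lemma eigenvalue_subinvariant e a : (forall x y, e x y = e y x) -> eigenvalue (adjmx R e) a ->
  exists y : 'I_n -> R, [/\ forall i, 0 <= y i, exists i, 0 < y i &
    forall j, `|a| * y j <= \sum_(i in nbh e [set: 'I_n] j) y i].
Proof.
move=> sym /eigenvalueP[v vA v0]; exists (fun i => `|v 0 i|); split=> //.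
  by have /rV0Pn[i vi] := v0; exists i; rewrite normr_gt0.
move=> j; have := congr1 (fun w : 'rV_n => w 0 j) vA; rewrite !mxE => h.
rewrite -normrM -{}h; apply: le_trans (ler_norm_sum _ _ _) _.
rewrite [leRHS]big_mkcond /=; apply: ler_sum => i _.
by rewrite in_nbhT mxE sym; case: (e j i); rewrite ?mulr1 ?mulr0 ?normr0.
Qed.

Lemma graph_iso_sym e1 e2 : graph_iso e1 e2 -> graph_iso e2 e1.
Proof.
move=> [f [[g fg gf] H]]; exists g; split; first by exists f.
by move=> x y; rewrite H !gf.
Qed.

Lemma eigenvalue_iso e1 e2 a : graph_iso e1 e2 ->
  eigenvalue (adjmx R e2) a -> eigenvalue (adjmx R e1) a.
Proof.
move=> [f [bf H]] /eigenvalueP[u uA u0]; apply/eigenvalueP.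
exists (\row_j u 0 (f j)).
  apply/rowP => j; have := congr1 (fun w : 'rV_n => w 0 (f j)) uA; rewrite !mxE => <-.
  rewrite [RHS](reindex f) /=; last exact: onW_bij.
  by apply: eq_bigr => i _; rewrite !mxE H.
have /rV0Pn[i ui] := u0; apply/rV0Pn; case: bf => g fg gf.
by exists (g i); rewrite mxE gf.
Qed.

Lemma rho_iso e1 e2 : graph_iso e1 e2 -> rho R e1 = rho R e2.
Proof.
move=> iso; rewrite /rho /spectral_radius; congr sup; congr image.
apply/seteqP; split=> a; apply: eigenvalue_iso => //; exact: graph_iso_sym.
Qed.

(** Strictness survives the supremum because the eigenvalues are the finitely many roots of the
    characteristic polynomial. *)
Lemma spectral_radius_lt (A : 'M[R]_n) (l : R) : 0 < l ->
  (forall a, eigenvalue A a -> `|a| < l) -> spectral_radius A < l.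
Proof.
move=> l0 H.
have p0 : char_poly A != 0 by apply: monic_neq0; exact: char_poly_monic.
pose s := polyrcf.rootsR (char_poly A).
have sE a : eigenvalue A a = (a \in s).
  by rewrite eigenvalue_root_char -(polyrcf.roots_on_rootsR p0) inE /= ?in_itv.
pose t := \big[Num.max/0]_(a <- s) `|a|.
have tl : t < l.
  rewrite /t big_seq_cond; elim/big_ind: _ => // [x y xl yl|a]; first by rewrite gt_max xl.
  by rewrite andbT -sE; exact: H.
apply: le_lt_trans tl; rewrite /spectral_radius.
have [->|/set0P ne] := eqVneq [set `|a| | a in [set a | eigenvalue A a]]%classic set0.
  (* Without eigenvalues [sup] has its default value 0, and the maximum [t] starts from 0. *)
  rewrite sup0 /t; elim/big_ind: _ => // x y xl yl.
  by rewrite le_max xl.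
apply: ge_sup => // _ [a /= ha <-]; rewrite sE in ha.
move: ha; rewrite /t; elim: (s) => // b r IH; rewrite inE big_cons le_max.
by case/orP=> [/eqP->|/IH->]; rewrite ?lexx ?orbT.
Qed.

End Spectrum.

(** The positive root of [l ^+ 2 = l + 2 * (n - 2)]. *)
Definition rhoK (R : realType) (n : nat) : R := (1 + Num.sqrt (8 * n%:R - 15)) / 2.

Lemma rhoK_eq (R : realType) n : (2 <= n)%N -> rhoK R n ^+ 2 = rhoK R n + 2 * (n%:R - 2).
Proof.
move=> n2; have h : 2 <= n%:R :> R by rewrite ler_nat.
have := @sqr_sqrtr R (8 * n%:R - 15); rewrite /rhoK; set q := Num.sqrt _ => qE.
have {}qE : q ^+ 2 = 8 * n%:R - 15 by apply: qE; lra.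
have -> : ((1 + q) / 2) ^+ 2 = (1 + 2 * q + q ^+ 2) / 4 by field.
by rewrite qE; field.
Qed.

Lemma rhoK_gt0 (R : realType) n : 0 < rhoK R n.
Proof. by rewrite /rhoK divr_gt0 // ltr_pwDl // sqrtr_ge0. Qed.

Lemma K2_join_H11_vector (R : realType) n (j : 'I_n) : (2 <= n)%N ->
  let w i : R := if (val i < 2)%N then rhoK R n else 2 in
  \sum_i w i * (K2_join_H11 i j)%:R = rhoK R n * w j.
Proof.
case: n j => [|[|m]] j // _ w.
have lE := rhoK_eq R (isT : (2 <= m.+2)%N).
pose o1 : 'I_m.+2 := lift ord0 ord0; pose o2 (i : 'I_m) : 'I_m.+2 := lift ord0 (lift ord0 i).
have -> : \sum_i w i * (K2_join_H11 i j)%:R = rhoK R m.+2 * (ord0 != j)%:R +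
    (rhoK R m.+2 * (o1 != j)%:R + \sum_(i < m) 2 * ((o2 i != j) && (val j < 2)%N)%:R).
  by rewrite !big_ord_recl /K2_join_H11 !andbT.
have mE : m.+2%:R = m%:R + 2 :> R by rewrite -addn2 natrD.
have [j2|j2] := ltnP j 2; rewrite /w; last first.
  rewrite [(_ < 2)%N]ltnNge j2 /= big1 => [|i _]; last by rewrite andbF mulr0.
  have -> : ord0 != j by rewrite -val_eqE /=; move: j2; case: (val j).
  have -> : o1 != j by rewrite -val_eqE /=; move: j2; case: (val j) => [|[]].
  by rewrite /=; ring.
rewrite j2 (eq_bigr (fun=> 2)) => [|i _]; last first.
  rewrite andbT (_ : o2 i != j) ?mulr1 //; apply/eqP => E; move: j2.
  by rewrite -E /= /bump; lia.
rewrite sumr_const card_ord -expr2 lE mE -mulr_natr.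
have [->|j0] := eqVneq j ord0; first by rewrite /=; ring.
have -> : j = o1 by apply/val_inj; move: j2 j0; rewrite -val_eqE /= /bump; lia.
by rewrite eqxx /=; ring.
Qed.

Lemma rho_K2_join_H11 (R : realType) n : (2 <= n)%N -> rho R (@K2_join_H11 n) = rhoK R n.
Proof.
move=> n2; pose w (i : 'I_n) : R := if (val i < 2)%N then rhoK R n else 2.
have w0 i : 0 < w i by rewrite /w; case: ifP => // _; exact: rhoK_gt0.
have wE j := K2_join_H11_vector R j n2.
have sym x y : @K2_join_H11 n x y = K2_join_H11 y x by rewrite /K2_join_H11 eq_sym orbC.
have eig : eigenvalue (adjmx R (@K2_join_H11 n)) (rhoK R n).
  apply/eigenvalueP; exists (\row_j w j).
    apply/rowP => j; rewrite !mxE -[RHS]wE; apply: eq_bigr => i _; by rewrite !mxE.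
  by apply/rV0Pn; exists (Ordinal n2); rewrite mxE gt_eqF.
have ub a : eigenvalue (adjmx R (@K2_join_H11 n)) a -> `|a| <= rhoK R n.
  move=> /(eigenvalue_subinvariant sym)[y [y0 [i0 yi0] ya]].
  (* Pairing the subinvariant vector [y] with the positive eigenvector [w] and using symmetry; the
     pairing is positive, so it cancels. *)
  have h : `|a| * (\sum_j w j * y j) <= rhoK R n * (\sum_j w j * y j).
    rewrite !mulr_sumr.
    rewrite [leRHS](eq_bigr (fun i => \sum_j w j * y i * (K2_join_H11 j i)%:R)); last first.
      move=> i _; rewrite mulrA -wE mulr_suml; apply: eq_bigr => j _.
      by rewrite mulrAC.
    rewrite exchange_big /=; apply: ler_sum => j _.
    rewrite mulrCA; apply: le_trans (ler_wpM2l (ltW (w0 j)) (ya j)) _.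
    rewrite mulr_sumr big_mkcond /=; apply: ler_sum => i _; rewrite in_nbhT.
    by case: (K2_join_H11 j i); rewrite ?mulr1 ?mulr0.
  rewrite ler_pM2r // in h; apply: lt_le_trans (_ : w i0 * y i0 <= _).
    by rewrite mulr_gt0.
  by rewrite (bigD1 i0) //= lerDl sumr_ge0 // => i _; rewrite mulr_ge0 // ltW.
rewrite /rho /spectral_radius; apply/eqP; rewrite eq_le; apply/andP; split.
  by apply: ge_sup; [exists `|rhoK R n|, (rhoK R n)|move=> _ [a /= /ub ha <-]].
apply: ub_le_sup; first by exists (rhoK R n) => _ [a /= /ub ha <-].
by exists (rhoK R n) => //; rewrite gtr0_norm // rhoK_gt0.
Qed.

(** * Identification of the extremal graph *)

Section Extremal.
Import mathcomp.boot.fintype mathcomp.boot.finset.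
Variables (R : realType) (n : nat) (e : rel 'I_n).

Lemma not_contains_C33_free : (forall x y, e x y = e y x) -> ~ contains_C33 e -> C33_free e.
Proof.
move=> sym H v a b c d un eva evb eab evc evd; apply/negP => ecd; apply: H.
exists (fun i => nth v [:: v; a; b; c; d] i); split.
  move=> i j /eqP; rewrite nth_uniq // => /eqP; exact: val_inj.
case=> -[|[|[|[|[|i]]]]] //= hi; case=> -[|[|[|[|[|j]]]]] //= hj _; rewrite // sym //.
Qed.

Lemma iso_of_dominating_pair z z' : sgraph e -> z' != z -> (2 <= n)%N ->
  (forall x y, e x y = (x != y) && ((x \in [set z; z']) || (y \in [set z; z']))) ->
  graph_iso e (@K2_join_H11 n).
Proof.
move=> ge zz' n2 eE.
pose o0 : 'I_n := Ordinal (ltnW n2); pose o1 : 'I_n := Ordinal n2.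
(* [w] is where the first transposition puts [z']; since [w] is not [o0], the second one leaves the
   image of [z] in place. *)
pose w := tperm z o0 z'.
pose f x := tperm w o1 (tperm z o0 x).
have wo0 : w != o0 by rewrite /w -{2}(tpermL z o0) (inj_eq perm_inj).
have fz : f z = o0 by rewrite /f tpermL tpermD //; rewrite 1?eq_sym.
have fz' : f z' = o1 by rewrite /f tpermL.
have fi : injective f by move=> x y /perm_inj/perm_inj.
exists f; split; first exact: injF_bij.
have lt2 x : (val (f x) < 2)%N = (x \in [set z; z']).
  rewrite !inE -(inj_eq fi x z) -(inj_eq fi x z') fz fz' -!val_eqE /=.
  by case: (val (f x)) => [|[|]].
by move=> x y; rewrite eE /K2_join_H11 !lt2 (inj_eq fi).
Qed.

Lemma iso_of_subinvariant (y : 'I_n -> R) : (216 * 10 ^ 15 <= n)%N ->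
  sgraph e -> weak_drawing R [set: 'I_n] e -> C33_free e ->
  (forall i, 0 <= y i) -> (exists i, 0 < y i) ->
  (forall j, rhoK R n * y j <= \sum_(i in nbh e [set: 'I_n] j) y i) ->
  graph_iso e (@K2_join_H11 n).
Proof.
move=> nN ge wd c33 y0 [i0 yi0] ly.
have n2 : (2 <= n)%N by apply: leq_trans nN; rewrite -[2%N]/(2 * 1)%N leq_mul // expn_gt0.
have [z _ zmax] := @arg_maxP _ R _ i0 xpredT y isT.
have yz : 0 < y z by apply: lt_le_trans yi0 (zmax i0 isT).
pose x i := y i / y z.
have x0 i : 0 <= x i by rewrite divr_ge0 // ltW.
have x1 i : x i <= 1 by rewrite ler_pdivrMr // mul1r; exact: zmax.
have xz : x z = 1 by rewrite /x divff // gt_eqF.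
have lx j : rhoK R n * x j <= \sum_(i in nbh e [set: 'I_n] j) x i.
  by rewrite -mulr_suml mulrA ler_wpM2r // invr_ge0 ltW.
have cV : 216 * 10 ^+ 15 <= n%:R :> R by rewrite -(natrX _ 10) -natrM ler_nat.
have nE : n%:R = #|'I_n|%:R :> R by rewrite card_ord.
have lE := rhoK_eq R n2.
have l0 := rhoK_gt0 R n.
have [z' zz' xz'] := second_vertex ge wd x0 x1 l0 lx nE cV lE xz.
have [ezz' dom] := dominating_pair ge wd c33 x0 x1 l0 lx nE cV lE xz zz' xz'.
apply: (iso_of_dominating_pair (z := z) (z' := z')) => // a b; rewrite !inE.
have [->|ab] := eqVneq a b; first by rewrite (negbTE (ge.1 b)).
have [az|az] := eqVneq a z.
  rewrite az; have [->|bz'] := eqVneq b z'; first by rewrite ezz'.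
  have bz : b != z by rewrite -az eq_sym.
  by rewrite (dom b bz bz').1.
have [az'|az'] := eqVneq a z'.
  rewrite az'; have [->|bz] := eqVneq b z; first by rewrite ge.2 ezz'.
  have bz' : b != z' by rewrite -az' eq_sym.
  by rewrite (dom b bz bz').2 orbT.
have [bz|bz] := eqVneq b z; first by rewrite bz ge.2 (dom a az az').1.
have [bz'|bz'] := eqVneq b z'; first by rewrite bz' ge.2 (dom a az az').2.
(* Two vertices outside the dominating pair are both neighbours of [z], so an edge between them
   would create a C_{3,3}. *)
rewrite /=; apply/negbTE; apply: (common_independent ge wd c33 x0 x1 l0 lx nE cV lE xz xz') => //.
  by case: (dom a az az').
by case: (dom b bz bz').
Qed.

End Extremal.

Theorem theorem1 (R : realType) (n : nat) (e : rel 'I_n) :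
  (216 * 10 ^ 15 <= n)%N ->
  simple_graph e -> planar R e -> ~ contains_C33 e ->
  rho R e <= rho R (@K2_join_H11 n) /\
  (rho R e = rho R (@K2_join_H11 n) <-> graph_iso e (@K2_join_H11 n)).
Proof.
move=> nN ge pl nC.
have n2 : (2 <= n)%N by apply: leq_trans nN; rewrite -[2%N]/(2 * 1)%N leq_mul // expn_gt0.
have [iso|niso] := pselect (graph_iso e (@K2_join_H11 n)).
  by rewrite (rho_iso R iso).
(* Isomorphic graphs have equal radius, so strict inequality in the remaining case settles both
   claims. *)
suff lt : rho R e < rho R (@K2_join_H11 n).
  by split; [exact: ltW|split=> // E; rewrite E ltxx in lt].
rewrite rho_K2_join_H11 //; apply: spectral_radius_lt; first exact: rhoK_gt0.
move=> a /(eigenvalue_subinvariant ge.2)[y [y0 yi ya]].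
rewrite ltNge; apply/negP => la; apply: niso.
apply: (iso_of_subinvariant nN ge (planar_weak_drawing ge.1 pl)
  (not_contains_C33_free ge.2 nC) y0 yi) => j.
by apply: le_trans (ya j); exact: ler_wpM2r.
Qed.
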